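(* Let $R\ge1$ and assume $X_n\to\infty$, $\mathbb{P}$-a.s. Then, for $P$-a.e. $\omega$, under $P_\omega$ the sequence $(U(i))_{i\le0}$ is an inhomogeneous multitype branching process in $\mathbb{R}^{1+2+\cdots+R}$ with the following immigration and offspring laws. (Immigration) For $0\le j\le R-1$, $$U(1)=e_{\kappa(j,1)}\ \text{ with probability }\ \frac{p_{j+1}(0)}{1-p_{(1)}(0)-\cdots-p_{(R)}(0)},$$ and for $0\le j\le R-2$ and $2\le m\le R-j$, $$U(1)=e_{\kappa(j,m)}\ \text{ with probability }\ \frac{p_{(\kappa(j+1,m-1))}(0)}{1-p_{(1)}(0)-\cdots-p_{(R)}(0)}.$$ (Offspring distribution) For all integers $u_1,\dots,u_R\ge0$: for $0\le j\le R-1$, $$P_\omega\big(U(0)=(u_1,\dots,u_R,0,\dots,0),\,U(1)=e_{\kappa(j,1)}\,\big|\,|U(1)|=1\big)=\frac{(u_1+\cdots+u_R)!}{u_1!\cdots u_R!}\,p_{(1)}(0)^{u_1}\cdots p_{(R)}(0)^{u_R}\,p_{j+1}(0),$$ and for $0\le j\le R-2$, $2\le m\le R-j$, $$P_\omega\big(U(0)=(u_1,\dots,u_R,0,\dots,0)+e_{\kappa(j+1,m-1)},\,U(1)=e_{\kappa(j,m)}\,\big|\,|U(1)|=1\big)=\frac{(u_1+\cdots+u_R)!}{u_1!\cdots u_R!}\,p_{(1)}(0)^{u_1}\cdots p_{(R)}(0)^{u_R}\,p_{(\kappa(j+1,m-1))}(0).$$ (Mean matrix) Furthermore, for $i\le0$,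 the offspring mean matrix of the $(-i+1)$-th generation is the $(1+2+\cdots+R)\times(1+2+\cdots+R)$ matrix $\widetilde N(i)=(\widetilde N_1(i)\ \ \widetilde N_2)$, where $\widetilde N_1(i)$ has size $(1+2+\cdots+R)\times R$ and all its rows equal $$\Big(\frac{p_{(1)}(i)}{1-p_{(1)}(i)-\cdots-p_{(R)}(i)},\ \dots,\ \frac{p_{(R)}(i)}{1-p_{(1)}(i)-\cdots-p_{(R)}(i)}\Big),$$ and $\widetilde N_2$ (which forms the columns of $\widetilde N(i)$ with indices $R+1,\dots,1+2+\cdots+R$) is the $0$–$1$ matrix whose row $\kappa(j,1)$ is zero for $0\le j\le R-1$, and whose row $\kappa(j,m)$, for $0\le j\le R-2$, $2\le m\le R-j$, has a single $1$, located in the column of $\widetilde N(i)$ with index $\kappa(j+1,m-1)$, and zeros elsewhere.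
   Context: **The $(1,R)$-random walk in random environment.** Fix an integer $R\ge1$. Let $\widetilde\Lambda=\{-1,1,\dots,R\}$ and $\mathcal{M}(\widetilde\Lambda)$ the set of probability measures on $\widetilde\Lambda$. An environment is $\omega=\{(q(\omega)_x,p_1(\omega)_x,\dots,p_R(\omega)_x):x\in\mathbb{Z}\}\in\widetilde\Omega:=\mathcal{M}(\widetilde\Lambda)^{\mathbb{Z}}$; write $q(x)=q(\omega)_x$, $p_z(x)=p_z(\omega)_x$. $\theta$ is the shift $(\theta\omega)_n=\omega_{n+1}$, and $P$ is a probability measure on $\widetilde\Omega$, stationary and ergodic under $\theta$, satisfying ellipticity: there is $\varepsilon>0$ with $p_z(0)/q(0)\ge\varepsilon$, $P$-a.s., for all $z\in\{1,\dots,R\}$. Given $\omega$, under $P_\omega$ the walk $\{X_n\}_{n\ge0}$ is the Markov chain on $\mathbb{Z}$ with $X_0=0$, $P_\omega(X_{n+1}=x-1|X_n=x)=q(x)$, $P_\omega(X_{n+1}=x+z|X_n=x)=p_z(x)$, $1\le z\le R$. $P_\omega^k$ is the law of the chain started at $k$; $\mathbb{P}=P\otimes P_\omega$ is the annealed law. $T_1=\inf\{n>0:X_n>0\}$. **Types.** After a step from $i$ to $i-1$, the walk first returns to $[i,\infty)$ (''crosses back'') by a jump from $i-m$ to $i+j$ for some $0\le j\le R-1$, $1\le m\le R-j$. These $1+2+\cdots+R$ possibilities are numbered in the order: $i-1\to i,\dots,i-R\to i$; $i-1\to i+1,\dots,i-R+1\to i+1$; $\dots$; $i-1\to i+R-1$.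 That is, the pair $(j,m)$ has number $$\kappa(j,m)=\sum_{l=0}^{j-1}(R-l)+m .$$ In particular $\kappa(0,m)=m$ for $1\le m\le R$. **The process $U$.** For $i\le0$, $U(i)=(U_1(i),\dots,U_{1+2+\cdots+R}(i))$, where $U_{\kappa(j,m)}(i)$ is the number of steps from $i$ to $i-1$ before time $T_1$ whose crossing-back is from $i-m$ to $i+j$. By convention $U(1)=e_{\kappa(j,m)}$ if the last jump, at time $T_1$, is from $1-m$ to $1+j$. Here $e_k$ is the $k$-th standard basis vector of $\mathbb{R}^{1+2+\cdots+R}$ and $|u|$ is the sum of the coordinates of $u$. **Probabilities $p_{(k)}(i)$.** For $k=\kappa(j,m)$, $p_{(k)}(i)$ is the $P_\omega^i$-probability that the walk jumps from $i$ to $i-1$ at its first step and then crosses back (first returns to $[i,\infty)$) by a jump from $i-m$ to $i+j$. (Note $p_z(i)$, without parentheses in the index, is the one-step jump probability.) **Branching process terminology.** $U(1)$ is the initial (immigrant) particle; $U(i)$ is the $(-i+1)$-th generation. ''Inhomogeneous multitype branching process'' means that $(U(1),U(0),U(-1),\dots)$ is a Markov chain in which, given $U(i+1)$, $U(i)$ is the sum of independent offspring vectors of the particles of $U(i+1)$, the offspring law depending on the particle's type and on $i$. The offspring mean matrix of the $(-i+1)$-th generation has $(k,l)$ entry equal to the expected number of type-$l$ particles of $U(i)$ produced by one type-$k$ particle of $U(i+1)$. *)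

(* Defs.v *)
From HB Require Import structures.
From mathcomp Require Import all_boot all_order all_algebra finmap.
From mathcomp Require Import all_classical all_reals all_analysis.

Set Implicit Arguments.
Unset Strict Implicit.
Unset Printing Implicit Defensive.

Import Order.TTheory GRing.Theory Num.Theory.
Import numFieldNormedType.Exports.

Local Open Scope classical_set_scope.
Local Open Scope ring_scope.

(* Throughout, K is the field of real numbers and R : nat is the maximal size
   of a jump to the right.  The set {-1, 1, ..., R} of jumps is indexed by
   'I_R.+1: index 0 is the jump -1, index z with 1 <= z <= R is the jump +z. *)
Definition jump (R : nat) (z : 'I_R.+1) : int :=
  if z == ord0 then -1 else (z : nat)%:Z.

Definition is_jump_law (K : realType) (R : nat) (p : {ffun 'I_R.+1 -> K}) :=
  [forall z, 0 <= p z] && (\sum_z p z == 1).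

Definition jump_law (K : realType) (R : nat) :=
  {p : {ffun 'I_R.+1 -> K} | is_jump_law p}.

Section jump_law_pointed.
Variables (K : realType) (R : nat).

Let p0 : {ffun 'I_R.+1 -> K} := [ffun z => (z == ord0)%:R].

Let p0P : is_jump_law p0.
Proof.
apply/andP; split; first by apply/forallP => z; rewrite ffunE ler0n.
rewrite (bigD1 ord0)//= ffunE eqxx big1 ?addr0// => z /negbTE z0.
by rewrite ffunE z0.
Qed.

HB.instance Definition _ := Choice.on (jump_law K R).
HB.instance Definition _ := isPointed.Build (jump_law K R) (Sub p0 p0P).
End jump_law_pointed.

(* The product sigma-algebra: generated by the coordinates. *)
Definition env_generators (K : realType) (R : nat) :
    set (set (int -> jump_law K R)) :=
  [set A | exists (x : int) (z : 'I_R.+1) (B : set K),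
     measurable B /\ A = [set w : int -> jump_law K R | B (val (w x) z)]].

Definition env (K : realType) (R : nat) : measurableType _ :=
  g_sigma_algebraType (@env_generators K R).

Definition q (K : realType) (R : nat) (w : env K R) (x : int) : K :=
  val (w x) ord0.

(* Only meaningful for 1 <= z <= R. *)
Definition p (K : realType) (R : nat) (w : env K R) (z : nat) (x : int) : K :=
  val (w x) (inord z).

Definition env_shift (K : realType) (R : nat) (w : env K R) : env K R :=
  fun n => w (n + 1).

Definition stationary (K : realType) (R : nat) (P : probability (env K R) K) :=
  forall A, measurable A -> P (@env_shift K R @^-1` A) = P A.

Definition ergodic (K : realType) (R : nat) (P : probability (env K R) K) :=
  forall A, measurable A -> @env_shift K R @^-1` A = A ->
    P A = 0%E \/ P A = 1%E.

(* The quotient is taken in \bar K, where p / 0 = +oo for p > 0. *)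
Definition elliptic (K : realType) (R : nat) (P : probability (env K R) K) :=
  exists2 eps : K, 0 < eps &
    {ae P, forall w, forall z, (1 <= z <= R)%N ->
       (eps%:E <= (p w z 0)%:E / (q w 0)%:E)%E}.

Definition traj_generators : set (set (nat -> int)) :=
  [set A | exists (n : nat) (y : int), A = [set x : nat -> int | x n = y]].

HB.instance Definition _ := isPointed.Build int 0.

Definition traj : measurableType _ := g_sigma_algebraType traj_generators.

Definition transition (K : realType) (R : nat) (w : env K R) (x y : int) : K :=
  \sum_(z < R.+1 | x + jump z == y) val (w x) z.

(* mu is the law of the Markov chain in the environment w started at k; the
   Markov property is multiplied out to avoid conditioning on null events. *)
Definition walk_law (K : realType) (R : nat) (w : env K R) (k : int)
    (mu : set traj -> \bar K) :=
  mu [set x | x 0%N = k] = 1%E /\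
  forall (n : nat) (s : nat -> int),
    mu [set x | forall t, (t <= n.+1)%N -> x t = s t] =
    (mu [set x | forall t, (t <= n)%N -> x t = s t]
     * (transition w (s n) (s n.+1))%:E)%E.

Definition annealed (K : realType) (R : nat) (P : probability (env K R) K)
    (Q : env K R -> {measure set traj -> \bar K})
    (A : set (env K R * traj)) : \bar K :=
  (\int[P]_w Q w (xsection A w))%E.

Definition ntypes (R : nat) : nat := (\sum_(1 <= l < R.+1) l)%N.

Definition kappa (R j m : nat) : nat := (\sum_(0 <= l < j) (R - l) + m)%N.

Definition type_pair (R j m : nat) : bool := (j < R)%N && (1 <= m <= R - j)%N.

(* After time n (where x n = i), the trajectory first returns to [i, +oo) by a
   jump from i - m to i + j; the times n + 1, ..., s are those spent below i. *)
Definition crosses_back (x : nat -> int) (n j m : nat) :=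
  exists s : nat, [/\ (n < s)%N,
    forall t, (n < t <= s)%N -> x t < x n,
    x s = x n - m%:Z & x s.+1 = x n + j%:Z].

(* Types are numbered from 1, as kappa does. *)
Definition down_step (R : nat) (x : nat -> int) (n : nat) (i : int) (k : nat) :=
  [/\ x n = i, x n.+1 = i - 1 &
    exists j m, [/\ type_pair R j m, k = kappa R j m & crosses_back x n j m]].

(* None stands for T_1 = +oo. *)
Definition T1 (x : nat -> int) : option nat :=
  if pselect (exists n : nat, (0 < n)%N && (0 < x n)) is left h
  then Some (ex_minn h) else None.

Definition before_T1 (x : nat -> int) (n : nat) : bool :=
  if T1 x is Some t then (n < t)%N else true.

(* Coordinate l : 'I_(ntypes R) of a vector is the one numbered l.+1. *)
Definition tvec (R : nat) := 'rV[nat]_(ntypes R).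

Definition evec (R k : nat) : tvec R := \row_l (l.+1 == k : nat).

(* (u_1, ..., u_R, 0, ..., 0) *)
Definition padvec (R : nat) (u : R.-tuple nat) : tvec R :=
  \row_l nth 0%N u l.

Definition vsize (R : nat) (v : tvec R) : nat := (\sum_l v ord0 l)%N.

(* The zero vector when T_1 = +oo. *)
Definition immigrant (R : nat) (x : nat -> int) : tvec R :=
  \row_l (`[< exists t j m, [/\ T1 x = Some t, type_pair R j m,
      l.+1 = kappa R j m, x t.-1 = 1 - m%:Z & x t = 1 + j%:Z] >] : nat).

(* The cardinal below is 0 by convention if the set is infinite, which can
   only happen when T_1 = +oo. *)
Definition U (R : nat) (i : int) (x : nat -> int) : tvec R :=
  if i == 1 then immigrant R x
  else \row_l #|` fset_set
         [set n | before_T1 x n /\ down_step R x n i l.+1] |%fset.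

(* Q i w is the law of the walk in the environment w started at i. *)
Definition pcross (K : realType) (R : nat)
    (Q : int -> env K R -> {measure set traj -> \bar K})
    (w : env K R) (k : nat) (i : int) : K :=
  fine (Q i w [set x | down_step R x 0 i k]).

Definition pstop (K : realType) (R : nat)
    (Q : int -> env K R -> {measure set traj -> \bar K})
    (w : env K R) (i : int) : K :=
  1 - \sum_(1 <= k < R.+1) pcross Q w k i.

Definition cond_prob d (T : measurableType d) (K : realType)
    (mu : {measure set T -> \bar K}) (A B : set T) : K :=
  fine (mu (A `&` B)) / fine (mu B).

Definition is_pmf (V : choiceType) (K : realType) (f : V -> K) :=
  (forall v, 0 <= f v) /\ (\esum_(v in setT) (f v)%:E = 1)%E.

Section sums_of_offspring.
Variables (K : realType) (R : nat).
Implicit Types f g : tvec R -> K.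

Definition pmf0 : tvec R -> K := fun v => (v == 0)%:R.

(* The set of pairs summing to v is finite. *)
Definition conv_pmf f g : tvec R -> K := fun v =>
  \sum_(ab \in [set ab : tvec R * tvec R | ab.1 + ab.2 = v]) f ab.1 * g ab.2.

(* Law of the sum of independent offspring vectors, one with law f k for each
   particle of type k in the population u. *)
Definition offspring_sum (f : 'I_(ntypes R) -> tvec R -> K) (u : tvec R) :
    tvec R -> K :=
  \big[conv_pmf/pmf0]_k iter (u ord0 k) (conv_pmf (f k)) pmf0.

(* The generations are V 1, V 0, V (-1), ... *)
Definition history (V : int -> traj -> tvec R) (n : nat) (u : nat -> tvec R) :
    set traj :=
  [set x | forall g : nat, (g <= n)%N -> V (1 - g%:Z) x = u g].

(* off i k is the law of the offspring in generation V i of one particle of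
   type k of V (i + 1), for i <= 0; the chain is (V 1, V 0, V (-1), ...), and
   the Markov property is multiplied out. *)
Definition branching_process (mu : {measure set traj -> \bar K})
    (V : int -> traj -> tvec R)
    (off : int -> 'I_(ntypes R) -> tvec R -> K) :=
  (forall i k, i <= 0 -> is_pmf (off i k)) /\
  forall (n : nat) (u : nat -> tvec R),
    mu (history V n.+1 u) =
    (mu (history V n u)
     * (offspring_sum (off (- n%:Z)) (u n) (u n.+1))%:E)%E.

End sums_of_offspring.

Definition multinomial_weight (K : realType) (R : nat)
    (Q : int -> env K R -> {measure set traj -> \bar K})
    (w : env K R) (i : int) (u : R.-tuple nat) : K :=
  ((\sum_(k < R) tnth u k)%N`!)%:R / (\prod_(k < R) (tnth u k)`!)%N%:R
  * \prod_(k < R) pcross Q w k.+1 i ^+ tnth u k.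

Definition mean_matrix (K : realType) (R : nat)
    (Q : int -> env K R -> {measure set traj -> \bar K})
    (w : env K R) (i : int) : 'M[K]_(ntypes R) :=
  \matrix_(k, l)
    if (l < R)%N then pcross Q w l.+1 i / pstop Q w i
    else `[< exists j m, [/\ (j + 2 <= R)%N, (2 <= m <= R - j)%N,
               k.+1 = kappa R j m & l.+1 = kappa R j.+1 m.-1] >]%:R.

(* Main.v *)
(* Cut the walk at the levels it visits. From a level i the path either jumps up
   at once, or steps down to i - 1 and follows the path up to its first time
   above i - 1; that excursion ends either exactly at i, and the path starts
   afresh from i, or above i, and the path is finished. Paths from i up to their
   first time above i are therefore coded by finite binary trees, whose weights
   multiply, and all the events at hand are, up to null sets, countable unions
   of cylinders indexed by trees. Let H(i, k, v_0 v_1 ...) be the total weight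
   of the trees of type k with v_g down-steps from level i - g. Splitting off the
   first loop at i gives
     H(i, k, v_0 :: vs) = [v_0 = d_k] c(i, k) P(d_k -> vs)
        + sum_l q(i) * sum_(a + b = vs) H(i - 1, l, a) * H(i, k, (v_0 - e_l) :: b)
   where l runs over the types of loops, c(i, k) is the probability of leaving i
   for good in the way prescribed by k and d_k records the down-step possibly
   used for that. The branching probabilities P solve the same recursion:
   multinomial weights are generated by removing the first particle, and the
   descendants of u + u' are distributed as the convolution of those of u and of
   u'. Transience is used only to get T_1 < oo, and ellipticity only to get
   q < 1. *)

Require Import Defs.
From HB Require Import structures.
From mathcomp Require Import all_boot all_order all_algebra finmap.
From mathcomp Require Import all_classical all_reals all_analysis.
From mathcomp Require Import measurable_realfun ring lra zify.

Set Implicit Arguments.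
Unset Strict Implicit.
Unset Printing Implicit Defensive.

Import Order.TTheory GRing.Theory Num.Theory.
Import numFieldNormedType.Exports.

Local Open Scope classical_set_scope.
Local Open Scope ring_scope.

(** * Ladder segments as trees *)

(* A tree codes a ladder segment, i.e. a path from a level i up to its first
   time above i: Up z is one jump by z + 1; Over t steps down to i - 1 and then
   follows t, which ends above i; Cat t1 t2 steps down to i - 1, follows t1,
   which ends exactly at i, and then follows t2. *)
Inductive tree (R : nat) : Type :=
| Up of 'I_R
| Over of tree R
| Cat of tree R & tree R.

Arguments Up {R}.

Section TreeCountable.
Variable R : nat.

(** This encoding makes [tree R] a countable type, so that unions indexed by trees stay measurable.
    The node label carries no information: the number of children separates [Over] from [Cat]. *)
Fixpoint tree_code (t : tree R) : GenTree.tree 'I_R :=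
  match t with
  | Up z => GenTree.Leaf z
  | Over t1 => GenTree.Node 0 [:: tree_code t1]
  | Cat t1 t2 => GenTree.Node 0 [:: tree_code t1; tree_code t2]
  end.

Fixpoint tree_decode (c : GenTree.tree 'I_R) : option (tree R) :=
  match c with
  | GenTree.Leaf z => Some (Up z)
  | GenTree.Node _ [:: c1] => omap (@Over R) (tree_decode c1)
  | GenTree.Node _ [:: c1; c2] =>
      if (tree_decode c1, tree_decode c2) is (Some t1, Some t2)
      then Some (Cat t1 t2) else None
  | _ => None
  end.

Lemma tree_codeK : pcancel tree_code tree_decode.
Proof. by elim=> //= [t ->|t1 -> t2 ->]. Qed.

HB.instance Definition _ := Countable.copy (tree R) (pcan_type tree_codeK).
End TreeCountable.

Section Trees.
Variable R : nat.
Implicit Types (t : tree R) (x : nat -> int) (a n g : nat).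

(* ttype t = (j, m) when the last jump goes from i + 1 - m to i + 1 + j, where
   i is the starting level. *)
Fixpoint ttype t : nat * nat :=
  match t with
  | Up z => (z : nat, 1%N)
  | Over t1 => ((ttype t1).1.-1, (ttype t1).2.+1)
  | Cat t1 t2 => ttype t2
  end.

(** The subtree [t1] starts at i - 1, so it ends at i plus the first component of its type. This
    offset must be positive for [Over], which is then finished, and zero for [Cat], which starts
    afresh from i. *)
Fixpoint wf t : bool :=
  match t with
  | Up _ => true
  | Over t1 => wf t1 && (0 < (ttype t1).1)%N
  | Cat t1 t2 => [&& wf t1, (ttype t1).1 == 0%N & wf t2]
  end.

Fixpoint tlen t : nat :=
  match t with
  | Up _ => 1
  | Over t1 => (tlen t1).+1
  | Cat t1 t2 => (tlen t1 + tlen t2).+1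
  end%N.

Definition tkappa t : nat := kappa R (ttype t).1 (ttype t).2.

(* Down-steps from level i - g, sorted by type. *)
Fixpoint tcnt t g : tvec R :=
  match t, g with
  | Up _, _ => 0
  | Over t1, 0%N => evec R (tkappa t1)
  | Over t1, g'.+1 => tcnt t1 g'
  | Cat t1 t2, 0%N => evec R (tkappa t1) + tcnt t2 0
  | Cat t1 t2, g'.+1 => tcnt t1 g' + tcnt t2 g
  end.

Fixpoint follows x a t : Prop :=
  match t with
  | Up z => x a.+1 = x a + (z.+1)%:Z
  | Over t1 => x a.+1 = x a - 1 /\ follows x a.+1 t1
  | Cat t1 t2 => [/\ x a.+1 = x a - 1, follows x a.+1 t1
                   & follows x (a.+1 + tlen t1)%N t2]
  end.

Lemma tlen_gt0 t : (0 < tlen t)%N. Proof. by case: t. Qed.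

Lemma wf_type_pair t : wf t -> type_pair R (ttype t).1 (ttype t).2.
Proof.
rewrite /type_pair; elim: t => /= [z _|t IH /andP[/IH + +]|t1 _ t2 IH /and3P[_ _ /IH //]].
- by have := ltn_ord z; lia.
- by move: (ttype t) => [j m] /=; lia.
Qed.

(** [follows] prescribes steps only; well-formedness makes them a genuine ladder segment. In the
    [Cat] case the excursion stays at or below i - 1 and is back exactly at i when the second
    subtree takes over. *)
Lemma follows_spec t x a : wf t -> follows x a t ->
  [/\ forall r, (a <= r < a + tlen t)%N -> x r <= x a,
      x (a + tlen t)%N = x a + 1 + (ttype t).1%:Z &
      x (a + (tlen t).-1)%N = x a + 1 - (ttype t).2%:Z].
Proof.
elim: t a => /= [z|t IH|t1 IH1 t2 IH2] a.
- move=> _ xa; split; rewrite ?addn0 ?addn1 //; last by lia.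
    by move=> r rP; have -> : r = a by lia.
  by rewrite xa; lia.
- move=> /andP[wt t1] [xa /(IH _ wt)[le_x e1 e2]]; split.
  + move=> r; rewrite leq_eqVlt => /andP[/orP[/eqP <- //|ar] rb].
    by have := le_x r; rewrite xa; lia.
  + by rewrite addnS -addSn e1 xa; lia.
  + have := tlen_gt0 t => t0; have -> : (a + tlen t = a.+1 + (tlen t).-1)%N by lia.
    by rewrite e2 xa; lia.
- move=> /and3P[wt1 /eqP t10 wt2] [xa /(IH1 _ wt1)[le1 e1 _] /(IH2 _ wt2)[le2 e2 e3]].
  have xc : x (a.+1 + tlen t1)%N = x a by rewrite e1 t10 xa; lia.
  have := tlen_gt0 t2 => t20.
  split.
  + move=> r rP; have [->//|ar] := eqVneq r a.
    have [rc|rc] := ltnP r (a.+1 + tlen t1)%N.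
      by have := le1 r; rewrite xa; lia.
    by have := le2 r; rewrite xc; apply; lia.
  + have -> : (a + (tlen t1 + tlen t2).+1 = a.+1 + tlen t1 + tlen t2)%N by lia.
    by rewrite e2 xc.
  + rewrite /=; have -> : (a + (tlen t1 + tlen t2) = a.+1 + tlen t1 + (tlen t2).-1)%N by lia.
    by rewrite e3 xc.
Qed.

(** The first step separates [Up] from the other two, and the end point of the first excursion
    separates [Over] from [Cat]. Hence the events attached to distinct trees are disjoint. *)
Lemma follows_inj t t' x a : wf t -> wf t' ->
  follows x a t -> follows x a t' -> t = t'.
Proof.
elim: t t' a => [z|t IH|t1 IH1 t2 IH2] [z'|t'|t1' t2'] a //=.
- by move=> _ _ -> e; congr Up; apply/val_inj => /=; lia.
- by move=> _ _ e [e' _]; lia.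
- by move=> _ _ e [e' _]; lia.
- by move=> _ _ [e _] e'; lia.
- by move=> /andP[wt _] /andP[wt' _] [_ f] [_ f']; rewrite (IH t' a.+1).
- move=> /andP[wt t0] /and3P[wt' t0' _] [_ f] [_ f' _].
  by move: t0; rewrite (IH t1' a.+1) // (eqP t0').
- by move=> _ _ [e _] e'; lia.
- move=> /and3P[wt' t0' _] /andP[wt t0] [_ f' _] [_ f].
  by move: t0; rewrite -(IH1 t' a.+1) // (eqP t0').
- move=> /and3P[w1 _ w2] /and3P[w1' _ w2'] [_ f1 f2] [_ f1' f2'].
  have e1 : t1 = t1' by apply: (IH1 _ a.+1).
  by rewrite -e1 in f2' *; rewrite (IH2 t2' (a.+1 + tlen t1)%N).
Qed.

Definition admissible x := forall n, exists z : 'I_R.+1, x n.+1 = x n + jump z.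

Lemma jumpP (z : 'I_R.+1) :
  jump z = -1 \/ exists z' : 'I_R, jump z = (z'.+1)%:Z.
Proof.
rewrite /jump; case: eqP => z0; [by left|right].
have zP : (z.-1 < R)%N by have := ltn_ord z; move: (z0) => /eqP; rewrite -val_eqE /=; lia.
by exists (Ordinal zP) => /=; rewrite prednK // lt0n; apply/eqP => e; apply: z0; apply/val_inj.
Qed.

(** Every ladder segment is coded by a tree, by strong induction on its duration. Down-steps have
    size one, so a first step down leads exactly to [x a - 1]. *)
Lemma ladder_follows x a b : admissible x -> (a < b)%N ->
  (forall r, (a <= r < b)%N -> x r <= x a) -> x a < x b ->
  exists t, [/\ wf t, follows x a t & (a + tlen t)%N = b].
Proof.
move=> xadm; have [N] := ubnP (b - a)%N; elim: N a b => // N IH a b abN ab le_x xab.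
have [z] := xadm a; case: (jumpP z) => [-> xa|[z' -> xa]]; last first.
  exists (Up z'); split => //=; rewrite addn1; apply/eqP; rewrite eqn_leq ab leqNgt.
  by apply/negP => a1b; have := le_x a.+1; rewrite xa; lia.
have a1b : (a.+1 < b)%N.
  by rewrite ltn_neqAle ab andbT; apply/eqP => e; move: xab; rewrite -e xa; lia.
(* The least such [c] is the first time above level [x a - 1], and it ends the first excursion. *)
have exc : exists c, (a.+1 < c)%N && (x a.+1 < x c) by exists b; rewrite a1b xa; lia.
case: (ex_minnP exc) => c /andP[ac xc] cmin.
have cb : (c <= b)%N by apply: cmin; rewrite a1b xa; lia.
have {}cmin r : (a.+1 <= r < c)%N -> x r <= x a.+1.
  move=> /andP[ar rc]; rewrite leNgt; apply/negP => xr.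
  have [e|ne] := eqVneq r a.+1; first by move: xr; rewrite e ltxx.
  by have := cmin r; rewrite xr andbT; lia.
have [|t1 [w1 f1 e1]] := IH a.+1 c _ ac cmin xc; first by lia.
have [_ xe _] := follows_spec w1 f1; rewrite e1 in xe.
(* An excursion that ends above [x a] ends the whole segment, so [c = b]. Otherwise it ends at
   [x a], and a shorter segment from the same level remains. *)
have [t10|t10] := posnP (ttype t1).1; last first.
  exists (Over t1); split => //=; first by rewrite w1.
  rewrite addnS -addSn e1; apply/eqP; rewrite eqn_leq cb leqNgt.
  by apply/negP => cb'; have := le_x c; rewrite xe xa; lia.
have xca : x c = x a by rewrite xe xa t10; lia.
have cb' : (c < b)%N by rewrite ltn_neqAle cb andbT; apply/eqP => e; move: xab; rewrite -e xca; lia.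
have [|||t2 [w2 f2 e2]] := IH c b _ cb'.
- by lia.
- by move=> r rP; rewrite xca; apply: le_x; lia.
- by rewrite xca.
exists (Cat t1 t2); split => /=; first by rewrite w1 t10 w2.
  by split => //; rewrite e1.
by rewrite -e2 -e1; lia.
Qed.
End Trees.

(** * Types and down-step counts *)

Section Kappa.
Variable R : nat.

Let tri (j : nat) : nat := (\sum_(0 <= l < j) (R - l))%N.

Lemma leq_triangle j j' : (j <= j')%N -> (tri j <= tri j')%N.
Proof. by move=> jj'; rewrite /tri [leqRHS](@big_cat_nat _ _ _ j) //= leq_addr. Qed.

Lemma kappa_range j m : type_pair R j m -> (tri j < kappa R j m <= tri j.+1)%N.
Proof. by rewrite /type_pair /kappa /tri big_nat_recr //=; lia. Qed.

(** The types with a given j occupy an interval of numbers, and these intervals are disjoint. The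
    number therefore determines j by its interval and m by its position there. *)
Lemma kappa_inj j m j' m' : type_pair R j m -> type_pair R j' m' ->
  kappa R j m = kappa R j' m' -> j = j' /\ m = m'.
Proof.
move=> /kappa_range h /kappa_range h' e; rewrite e in h.
have jj' : j = j'.
  apply/eqP; rewrite eqn_leq; apply/andP; split; rewrite leqNgt; apply/negP.
    by move=> /leq_triangle; lia.
  by move=> /leq_triangle; lia.
by split => //; move: e; rewrite /kappa jj'; lia.
Qed.

Lemma ntypesE : ntypes R = tri R.
Proof.
rewrite /ntypes /tri big_add1 /= big_nat_rev /= add0n.
by apply: eq_big_nat => i /andP[_ iR]; rewrite subnSK.
Qed.

Lemma kappa_le j m : type_pair R j m -> (0 < kappa R j m <= ntypes R)%N.
Proof.
move=> h; have /andP[h1 h2] := kappa_range h; rewrite ntypesE.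
have /leq_triangle : (j.+1 <= R)%N by case/andP: h.
by lia.
Qed.

Lemma kappa0 m : kappa R 0 m = m.
Proof. by rewrite /kappa big_nil. Qed.

Lemma kappaS_gt j m : type_pair R j.+1 m -> (R < kappa R j.+1 m)%N.
Proof.
move=> h; have /andP[h1 _] := kappa_range h; apply: leq_ltn_trans h1.
by apply: leq_trans (leq_triangle (ltn0Sn j)); rewrite /tri big_nat1; lia.
Qed.

Lemma leq_ntypes : (R <= ntypes R)%N.
Proof.
have [->//|R0] := posnP R; have : type_pair R 0 R by rewrite /type_pair; lia.
by move=> /kappa_le; rewrite kappa0 => /andP[].
Qed.

End Kappa.

Section Counts.
Variable R : nat.
Implicit Types (t : tree R) (x : nat -> int) (a n g : nat).

Lemma down_step_tree t x a k : wf t -> x a.+1 = x a - 1 -> follows x a.+1 t ->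
  down_step R x a (x a) k <-> k = tkappa t.
Proof.
move=> wt xa ft; have [le1 e1 e2] := follows_spec wt ft.
have t0 := tlen_gt0 t.
have back : crosses_back x a (ttype t).1 (ttype t).2.
  exists (a.+1 + (tlen t).-1)%N; split; first by lia.
  - by move=> r rP; have := le1 r; rewrite xa; lia.
  - by rewrite e2 xa; lia.
  - rewrite (_ : (_.+1 = a.+1 + tlen t)%N); last by lia.
    by rewrite e1 xa; lia.
split=> [[_ _ [j [m [jm -> [s [as_ xs e3 e4]]]]]]|->]; last first.
  by split => //; exists (ttype t).1, (ttype t).2; split => //; apply: wf_type_pair.
(* Both times are the first return to [[x a, +oo)]: the tree stays at or below [x a - 1] until its
   end and ends at or above [x a]. *)
have sE : (s.+1 = a.+1 + tlen t)%N.
  apply/eqP; rewrite eqn_leq; apply/andP; split; rewrite leqNgt; apply/negP => h.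
    by have := xs (a.+1 + tlen t)%N; rewrite e1 xa; lia.
  by have := le1 s.+1; rewrite e4 xa; lia.
have sE' : s = (a.+1 + (tlen t).-1)%N by lia.
rewrite /tkappa; congr kappa.
  by move: e4; rewrite sE e1 xa; lia.
by move: e3; rewrite sE' e2 xa; lia.
Qed.

(** The time interval is cut where the tree is cut. A subtree started at i - 1 sees level i - g at
    depth g - 1, and for g = 0 an excursion contributes only its initial down-step, handled by
    [first]. *)
Lemma follows_count t x a g (l : 'I_(ntypes R)) : wf t -> follows x a t ->
  (\sum_(a <= n < a + tlen t) `[< down_step R x n (x a - g%:Z) l.+1 >])%N
  = tcnt t g ord0 l.
Proof.
have first t1 a' g' : wf t1 -> x a'.+1 = x a' - 1 -> follows x a'.+1 t1 ->
    (`[< down_step R x a' (x a' - g'%:Z) l.+1 >] : nat) =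
    if g' is 0%N then evec R (tkappa t1) ord0 l else 0%N.
  move=> w1 xa f1; case: g' => [|g'].
    rewrite subr0 mxE; congr nat_of_bool.
    by apply/asboolP/eqP => /(down_step_tree _ w1 xa f1).
  by rewrite asboolF // => -[e _ _]; move: e; lia.
elim: t a g => /= [z|t IH|t1 IH1 t2 IH2] a g.
- move=> _ xa; rewrite addn1 big_nat1 asboolF ?mxE // => -[e1 e2 _].
  by move: e2; rewrite xa; lia.
- move=> /andP[wt t0] [xa ft]; rewrite big_ltn; last by lia.
  rewrite addnS -addSn (first t) //; case: g => [|g].
    rewrite big1_seq ?addn0 // => n; rewrite mem_index_iota => /= nP.
    rewrite asboolF // => -[e _ _]; have [le1 _ _] := follows_spec wt ft.
    by have := le1 n nP; rewrite e xa; lia.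
  rewrite -(IH a.+1 g wt ft) add0n; apply: eq_bigr => n _; rewrite xa;
    congr (nat_of_bool `[< down_step _ _ _ _ _ >]); lia.
- move=> /and3P[w1 t10 w2] [xa f1 f2]; rewrite big_ltn; last by lia.
  rewrite (first t1) //.
  have [le1 e1 _] := follows_spec w1 f1.
  have xc : x (a.+1 + tlen t1)%N = x a by rewrite e1 (eqP t10) xa; lia.
  have -> : (a + (tlen t1 + tlen t2).+1 = a.+1 + tlen t1 + tlen t2)%N by lia.
  rewrite (@big_cat_nat _ _ _ (a.+1 + tlen t1)%N) /=; [|lia|lia].
  have := IH2 _ g w2 f2; rewrite xc => ->.
  case: g => [|g].
    rewrite big1_seq ?add0n ?mxE // => n; rewrite mem_index_iota => /= nP.
    rewrite asboolF // => -[e _ _].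
    by have := le1 n nP; rewrite e xa; lia.
  rewrite mxE -(IH1 a.+1 g w1 f1) add0n; congr addn; apply: eq_bigr => n _; rewrite xa.
  by congr (nat_of_bool `[< down_step _ _ _ _ _ >]); lia.
Qed.

Lemma T1P x n : T1 x = Some n <->
  [/\ (0 < n)%N, 0 < x n & forall r, (0 < r < n)%N -> x r <= 0].
Proof.
rewrite /T1; case: pselect => [h|h]; last first.
  by split => // -[n0 xn _]; exfalso; apply: h; exists n; rewrite n0.
case: (ex_minnP h) => b /andP[b0 xb] bmin; split => [[<-]|[n0 xn le0]].
  split => // r rP; rewrite leNgt; apply/negP => xr.
  by have := bmin r; rewrite xr andbT; lia.
congr Some; apply/eqP; rewrite eqn_leq bmin ?n0 //= leqNgt; apply/negP => bn.
by have := le0 b; lia.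
Qed.

Lemma before_T1P x n :
  before_T1 x n <-> forall r, (0 < r <= n)%N -> x r <= 0.
Proof.
rewrite /before_T1; case E: (T1 x) => [b|].
  have [b0 xb le0] := (T1P x b).1 E; split => [nb r rP|h].
    by apply: le0; lia.
  by rewrite ltnNge; apply/negP => bn; have := h b; lia.
split => // _ r rP; rewrite leNgt; apply/negP => xr.
move: E; rewrite /T1; case: pselect => // -[].
by exists r; lia.
Qed.

Lemma follows_T1 t x : wf t -> follows x 0 t -> x 0%N = 0 ->
  T1 x = Some (tlen t).
Proof.
move=> wt ft x0; have [le1 e1 _] := follows_spec wt ft; rewrite x0 in le1 e1.
apply/T1P; split; [exact: tlen_gt0| |].
- by move: e1; rewrite add0n => ->; lia.
- by move=> r rP; apply: le1; lia.
Qed.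

Lemma U1_tree t x : wf t -> follows x 0 t -> x 0%N = 0 ->
  U R 1 x = evec R (tkappa t).
Proof.
move=> wt ft x0; rewrite /U eqxx; apply/rowP => l; rewrite !mxE.
have [_ e1 e2] := follows_spec wt ft; rewrite x0 in e1 e2.
have tT := follows_T1 wt ft x0; congr nat_of_bool; apply/asboolP/eqP.
  move=> [b [j [m [bT jm -> e3 e4]]]].
  have {}bT : b = tlen t by move: bT; rewrite tT => -[].
  by rewrite bT in e3 e4; rewrite /tkappa; congr kappa; move: e1 e2; rewrite !add0n; lia.
move=> ->; exists (tlen t), (ttype t).1, (ttype t).2; split => //.
exact: wf_type_pair.
Qed.

(** A sum over times can be cut along a tree and is measurable by induction on its length; the
    cardinals in [U] are converted to such sums. *)
Lemma card_nat_count (B : nat) (A : nat -> Prop) :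
  (forall n, A n -> (n < B)%N) ->
  (#|` fset_set [set n | A n]| = \sum_(0 <= n < B) `[< A n >])%N%fset.
Proof.
move=> AB.
have -> : fset_set [set n | A n] =
    [fset n in [seq n <- index_iota 0 B | `[< A n >]]]%fset.
  apply/fsetP => n; rewrite in_fset_set; last first.
    by apply: (@sub_finite_set _ _ `I_B) => // m /AB.
  rewrite inE mem_filter mem_index_iota /=; apply/idP/andP.
    by rewrite inE /= => An; split => //; exact: AB.
  by case=> /asboolP An _; rewrite inE.
rewrite card_fseq undup_id ?filter_uniq ?iota_uniq // size_filter -sum1_count.
by rewrite big_mkcond; apply: eq_bigr => n _; case: asboolP.
Qed.

Lemma U_tree t x g : wf t -> follows x 0 t -> x 0%N = 0 ->
  U R (- g%:Z) x = tcnt t g.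
Proof.
move=> wt ft x0; rewrite /U ifF; last by lia.
have tT := follows_T1 wt ft x0; apply/rowP => l; rewrite mxE.
rewrite (@card_nat_count (tlen t)); last by move=> n []; rewrite /before_T1 tT.
rewrite -(follows_count g l wt ft) x0 add0n sub0r; apply: eq_big_nat => n nP.
congr nat_of_bool; apply/asbool_equiv_eq; split => [[]//|h]; split => //.
by rewrite /before_T1 tT.
Qed.

End Counts.

(** * Measurability of path events *)

Section TrajMeasurable.
Implicit Types (E F : traj -> Prop).

Lemma meas_coord (n : nat) (y : int) : measurable [set x : traj | x n = y].
Proof. by apply: sub_sigma_algebra; exists n, y. Qed.

Lemma meas_not E : measurable [set x | E x] -> measurable [set x | ~ E x].
Proof. by move=> mE; rewrite [X in measurable X](_ : _ = ~` [set x | E x]) //;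
  exact: measurableC. Qed.

Lemma meas_and E F : measurable [set x | E x] -> measurable [set x | F x] ->
  measurable [set x | E x /\ F x].
Proof. by move=> mE mF; exact: measurableI. Qed.

Lemma meas_or E F : measurable [set x | E x] -> measurable [set x | F x] ->
  measurable [set x | E x \/ F x].
Proof. by move=> mE mF; exact: measurableU. Qed.

Lemma meas_ex (C : countType) (E : C -> traj -> Prop) :
  (forall c, measurable [set x | E c x]) -> measurable [set x | exists c, E c x].
Proof.
move=> mE; rewrite [X in measurable X](_ : _ = \bigcup_c [set x | E c x]).
  by apply: countable_bigcupT_measurable => //; exact: countableP.
by apply/seteqP; split => x [c]; [exists c|move=> _; exists c].
Qed.

Lemma meas_all (C : countType) (E : C -> traj -> Prop) :
  (forall c, measurable [set x | E c x]) -> measurable [set x | forall c, E c x].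
Proof.
move=> mE; rewrite [X in measurable X](_ : _ = [set x | ~ exists c, ~ E c x]).
  by apply: meas_not; apply: meas_ex => c; apply: meas_not; exact: mE.
by apply/seteqP; split => [x h [c]|x h c] //=; apply: contrapT => nE; apply: h; exists c.
Qed.

Lemma meas_cst (P : Prop) : measurable [set x : traj | P].
Proof.
have [p|np] := pselect P.
  by rewrite [X in measurable X](_ : _ = setT) //; apply/seteqP; split.
by rewrite [X in measurable X](_ : _ = set0) //; apply/seteqP; split.
Qed.

Lemma meas_imp E F : measurable [set x | E x] -> measurable [set x | F x] ->
  measurable [set x | E x -> F x].
Proof.
move=> mE mF; rewrite [X in measurable X](_ : _ = [set x | ~ E x \/ F x]).
  by apply: meas_or => //; apply: meas_not.
apply/seteqP; split => x /=; last by case.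
by move=> EF; have [/EF|] := pselect (E x); [right|left].
Qed.

Lemma meas_iff E F : (forall x, E x <-> F x) -> measurable [set x | F x] ->
  measurable [set x | E x].
Proof.
by move=> EF; rewrite (_ : [set x | E x] = [set x | F x]) //; apply/seteqP; split => x /EF.
Qed.

(** The state space is countable, so any relation between two coordinates is a countable union over
    their values. *)
Lemma meas_rel (r : int -> int -> Prop) (n m : nat) :
  measurable [set x : traj | r (x n) (x m)].
Proof.
apply: (@meas_iff _ (fun x => exists y, x n = y /\ exists z, x m = z /\ r y z)).
  by move=> x; split => [h|[y [-> [z [-> //]]]]]; exists (x n); split => //; exists (x m).
apply: meas_ex => y; apply: meas_and; first exact: meas_coord.
by apply: meas_ex => z; apply: meas_and; [exact: meas_coord|exact: meas_cst].
Qed.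

Lemma meas_pred (r : int -> Prop) (n : nat) : measurable [set x : traj | r (x n)].
Proof. exact: (meas_rel (fun y _ => r y) n n). Qed.

Lemma meas_cyl (n : nat) (s : nat -> int) :
  measurable [set x : traj | forall t, (t <= n)%N -> x t = s t].
Proof.
by apply: meas_all => t; apply: meas_imp; [exact: meas_cst|exact: meas_coord].
Qed.

Lemma meas_crosses_back n j m : measurable [set x : traj | crosses_back x n j m].
Proof.
apply: (@meas_iff _ (fun x => exists s : nat, (n < s)%N /\
    (forall t : nat, (n < t <= s)%N -> x t < x n) /\
    (x s = x n - m%:Z /\ x s.+1 = x n + j%:Z))).
  by move=> x; split => [[s [? ? ? ?]]|[s [? [? [? ?]]]]]; exists s.
apply: meas_ex => s; apply: meas_and; first exact: meas_cst.
apply: meas_and.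
  apply: meas_all => t; apply: meas_imp; first exact: meas_cst.
  exact: (meas_rel (fun y z => y < z)).
apply: meas_and; [exact: (meas_rel (fun y z => y = z - m%:Z))|].
exact: (meas_rel (fun y z => y = z + j%:Z)).
Qed.

Lemma meas_down_step R n i k : measurable [set x : traj | down_step R x n i k].
Proof.
apply: (@meas_iff _ (fun x => (x n = i /\ x n.+1 = i - 1) /\
    exists j m : nat, (type_pair R j m /\ k = kappa R j m) /\ crosses_back x n j m)).
  move=> x; split => [[? ? [j [m [? ? ?]]]]|[[? ?] [j [m [[? ?] ?]]]]].
    by split => //; exists j, m.
  by split => //; exists j, m.
apply: meas_and; first by apply: meas_and; exact: meas_coord.
apply: meas_ex => j; apply: meas_ex => m; apply: meas_and; first exact: meas_cst.
exact: meas_crosses_back.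
Qed.

Lemma meas_before_T1 n : measurable [set x : traj | before_T1 x n].
Proof.
apply: (@meas_iff _ (fun x => forall r : nat, (0 < r <= n)%N -> x r <= 0)).
  by move=> x; exact: before_T1P.
by apply: meas_all => r; apply: meas_imp; [exact: meas_cst|exact: (meas_pred (fun y => y <= 0))].
Qed.

Lemma meas_T1 n : measurable [set x : traj | T1 x = Some n].
Proof.
apply: (@meas_iff _ (fun x => ((0 < n)%N /\ 0 < x n) /\
    forall r : nat, (0 < r < n)%N -> x r <= 0)).
  by move=> x; rewrite T1P; split => [[]|[[]]].
apply: meas_and; first by apply: meas_and; [exact: meas_cst|exact: (meas_pred (fun y => 0 < y))].
by apply: meas_all => r; apply: meas_imp; [exact: meas_cst|exact: (meas_pred (fun y => y <= 0))].
Qed.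

Lemma meas_bool E (b : bool) : measurable [set x | E x] ->
  measurable [set x | `[< E x >] = b].
Proof.
case: b => mE.
  by apply: (meas_iff (F := E)) => // x; split => /asboolP.
apply: (meas_iff (F := fun x => ~ E x)); last exact: meas_not.
by move=> x; split => [/negbT/asboolP|h] //; apply/negbTE/asboolP.
Qed.

Lemma meas_count (A : nat -> traj -> Prop) (N c : nat) :
  (forall n, measurable [set x | A n x]) ->
  measurable [set x | (\sum_(0 <= n < N) `[< A n x >])%N = c].
Proof.
move=> mA; elim: N c => [|N IH] c.
  by apply: (meas_iff (F := fun=> 0%N = c)); [move=> x; rewrite big_nil|exact: meas_cst].
apply: (meas_iff (F := fun x => exists d : nat,
    (\sum_(0 <= n < N) `[< A n x >])%N = d /\ exists b : bool, `[< A N x >] = b /\ (d + b)%N = c)).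
  move=> x; rewrite big_nat_recr //=; split => [h|[d [-> [b [-> //]]]]].
  by exists (\sum_(0 <= n < N) `[< A n x >])%N; split => //; exists `[< A N x >].
apply: meas_ex => d; apply: meas_and; first exact: IH.
by apply: meas_ex => b; apply: meas_and; [exact: meas_bool|exact: meas_cst].
Qed.

Lemma meas_card (A : nat -> traj -> Prop) (c : nat) :
  (forall n, measurable [set x | A n x]) ->
  measurable [set x | #|` fset_set [set n | A n x] |%fset = c].
Proof.
(* The set of times is either bounded, and its cardinal is a finite sum, or infinite, and [fset_set]
   gives the default cardinal 0. *)
move=> mA; apply: (meas_iff (F := fun x =>
   (exists N : nat, (forall n : nat, A n x -> (n < N)%N) /\
                    (\sum_(0 <= n < N) `[< A n x >])%N = c) \/
   ((~ exists N : nat, forall n : nat, A n x -> (n < N)%N) /\ 0%N = c))).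
  move=> x; have [[N AN]|nN] := pselect (exists N : nat, forall n, A n x -> (n < N)%N).
    rewrite (card_nat_count AN); split => [h|]; first by left; exists N.
    case=> [[M [AM <-]]|[[]]]; last by exists N.
    by rewrite -(card_nat_count AN) (card_nat_count AM).
  have -> : fset_set [set n | A n x] = fset0.
    rewrite /fset_set; case: pselect => // finA; exfalso; apply: nN.
    exists (\max_(n <- fset_set [set n | A n x]) n).+1 => n An.
    by rewrite ltnS; apply: leq_bigmax_seq => //; rewrite in_fset_set // inE.
  rewrite cardfs0; split => [h|[[N [AN _]]|[_ //]]]; first by right.
  by exfalso; apply: nN; exists N.
have mb N : measurable [set x | forall n : nat, A n x -> (n < N)%N].
  by apply: meas_all => n; apply: meas_imp => //; exact: meas_cst.
apply: meas_or.
  by apply: meas_ex => N; apply: meas_and => //; exact: meas_count.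
by apply: meas_and; [apply: meas_not; exact: meas_ex|exact: meas_cst].
Qed.

Lemma meas_row R (f : 'I_(ntypes R) -> traj -> nat) :
  (forall l c, measurable [set x | f l x = c]) ->
  forall v : tvec R, measurable [set x | (\row_l f l x : tvec R) = v].
Proof.
move=> mf v; apply: (meas_iff (F := fun x => forall l, f l x = v ord0 l)).
  by move=> x; split => [<- l|h]; [rewrite mxE|apply/rowP => l; rewrite mxE].
by apply: meas_all => l.
Qed.

Lemma meas_U R i (v : tvec R) : measurable [set x : traj | U R i x = v].
Proof.
rewrite /U; case: (i == 1); apply: meas_row => l c.
  apply: (meas_iff (F := fun x => exists b : bool, `[< exists t j m : nat,
    T1 x = Some t /\ (type_pair R j m /\ l.+1 = kappa R j m) /\
    (x t.-1 = 1 - m%:Z /\ x t = 1 + j%:Z) >] = b /\ b = c :> nat)).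
    move=> x; set b0 := `[< _ >]; set b1 := `[< _ >].
    have -> : b0 = b1.
      apply: asbool_equiv_eq; split => -[t [j [m]]].
        by move=> [? ? ? ? ?]; exists t, j, m.
      by move=> [? [[? ?] [? ?]]]; exists t, j, m.
    by split => [h|[b [<- //]]]; exists b1.
  apply: meas_ex => b; apply: meas_and; last exact: meas_cst.
  apply: meas_bool; apply: meas_ex => t; apply: meas_ex => j; apply: meas_ex => m.
  apply: meas_and; first exact: meas_T1.
  by apply: meas_and; [exact: meas_cst|apply: meas_and; exact: meas_coord].
by apply: meas_card => n; apply: meas_and; [exact: meas_before_T1|exact: meas_down_step].
Qed.

End TrajMeasurable.

(** * Sums over countable sets *)

Section Esum.
Local Open Scope ereal_scope.
Variable K : realType.

Lemma ge0_esumZl (T : choiceType) (A : set T) (c : \bar K) (a : T -> \bar K) :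
  0 <= c -> (forall t, A t -> 0 <= a t) ->
  \esum_(t in A) (c * a t) = c * \esum_(t in A) a t.
Proof.
case: c => [c| |] // c0 a0.
  rewrite /esum -ereal_supZl; last 2 first.
  - by apply/set0P; exists 0; exists set0; [exact: fsets_set0|exact: fsbig_set0].
  - by rewrite -lee_fin.
  congr ereal_sup; apply/seteqP; split => [_ [X [finX XA] <-]|_ [_ [X [finX XA] <-] <-]].
    exists (\sum_(t \in X) a t); first by exists X.
    rewrite !fsbig_finite //= big_seq [RHS]big_seq -ge0_sume_distrr // => t.
    by rewrite in_fset_set // inE => /XA /a0.
  exists X => //.
  rewrite !fsbig_finite //= big_seq [in RHS]big_seq ge0_sume_distrr // => t.
  by rewrite in_fset_set // inE => /XA /a0.
(* For c = +oo both sides vanish if all terms do, and both are +oo as soon as one term is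
   positive. *)
have [az|naz] := pselect (forall t, A t -> a t = 0).
  by rewrite !esum1 ?mule0 // => t At; rewrite az // mule0.
have [t [At at0]] : exists t, A t /\ 0 < a t.
  apply: contrapT => h; apply: naz => t At; apply/eqP; rewrite eq_le a0 // andbT.
  by rewrite leNgt; apply/negP => at0; apply: h; exists t.
have ge (f : T -> \bar K) : (forall t, A t -> 0 <= f t) -> f t <= \esum_(t in A) f t.
  move=> f0; rewrite -(esum_set1 (f0 t At)) esum_ge //; exists [set t].
    by split; [exact: finite_set1|move=> _ ->].
  by rewrite fsbig_set1 (esum_set1 (f0 t At)).
rewrite gt0_mulye ?(lt_le_trans at0 (ge _ a0)) //.
apply/eqP; rewrite -leye_eq; apply: le_trans (ge _ _).
  by rewrite gt0_mulye.
by move=> t' At'; rewrite mule_ge0 ?a0.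
Qed.

Lemma ge0_esumZr (T : choiceType) (A : set T) (c : \bar K) (a : T -> \bar K) :
  0 <= c -> (forall t, A t -> 0 <= a t) ->
  \esum_(t in A) (a t * c) = (\esum_(t in A) a t) * c.
Proof.
move=> c0 a0; rewrite muleC -ge0_esumZl //; apply: eq_esum => t _.
by rewrite muleC.
Qed.

Lemma esum_setX (S T : choiceType) (A : set S) (B : set T) (f : S -> \bar K) (g : T -> \bar K) :
  (forall s, A s -> 0 <= f s) -> (forall t, B t -> 0 <= g t) ->
  \esum_(st in A `*` B) (f st.1 * g st.2) =
  (\esum_(s in A) f s) * (\esum_(t in B) g t).
Proof.
move=> f0 g0; rewrite -ge0_esumZr //; last exact: esum_ge0.
rewrite (_ : A `*` B = A `*`` (fun=> B)) // -(esum_esum (a := fun s t => f s * g t)).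
  by apply: eq_esum => s As; rewrite ge0_esumZl ?f0.
by move=> s t As Bt; rewrite mule_ge0 ?f0 ?g0.
Qed.

Lemma esum_fibre (S T : choiceType) (A : set S) (B : set T) (phi : S -> T) (f : S -> \bar K) :
  (forall s, A s -> B (phi s)) -> (forall s, A s -> 0 <= f s) ->
  \esum_(s in A) f s = \esum_(t in B) \esum_(s in [set s | A s /\ phi s = t]) f s.
Proof.
move=> AB f0; rewrite esum_esum; last by move=> t s _ [/f0].
apply: (reindex_esum _ _ (fun ts => ts.2)); split.
- by move=> [t s] [/= _ []].
- by move=> [t s] [t' s'] /[!inE] -[/= _ [_ <-]] [/= _ [_ <-]] ->.
- by move=> s As; exists (phi s, s) => //; split; [exact: AB|].
Qed.

(** The constraint depends on a pair only through its image by [phi] and [psi]. The fibres of the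
    image are rectangles, over which the sum of products factorizes. *)
Lemma esum_conv (S S' T T' : choiceType) (A : set S) (A' : set S')
    (phi : S -> T) (psi : S' -> T') (C : set (T * T'))
    (f : S -> \bar K) (g : S' -> \bar K) :
  (forall s, 0 <= f s) -> (forall s, 0 <= g s) ->
  \esum_(ss in [set ss | [/\ A ss.1, A' ss.2 & C (phi ss.1, psi ss.2)]]) (f ss.1 * g ss.2) =
  \esum_(tt in C) ((\esum_(s in [set s | A s /\ phi s = tt.1]) f s) *
                   (\esum_(s in [set s | A' s /\ psi s = tt.2]) g s)).
Proof.
move=> f0 g0.
rewrite (esum_fibre (B := C) (phi := fun ss => (phi ss.1, psi ss.2))); last 2 first.
- by move=> ss [].
- by move=> ss _; rewrite mule_ge0.
apply: eq_esum => -[t t'] Ct /=.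
rewrite -esum_setX //; congr (esum _ _); apply/seteqP; split => -[s s'] /=.
  by move=> [[As As' _] e]; case: e => <- <-.
by move=> [[As e1] [As' e2]]; rewrite /= in e1 e2 *; rewrite e1 e2.
Qed.

End Esum.

(** * Tree weights and the law of the walk *)

Lemma measure_bigcup_count d (T : measurableType d) (K : realType) (C : countType)
    (mu : {measure set T -> \bar K}) (D : set C) (F : C -> set T) :
  (forall c, D c -> measurable (F c)) -> trivIset D F ->
  mu (\bigcup_(c in D) F c) = (\esum_(c in D) mu (F c))%E.
Proof.
move=> mF tF; pose G n := if choice.unpickle n is Some c then F c else set0.
have GE c : G (choice.pickle c) = F c by rewrite /G choice.pickleK.
have -> : \bigcup_(c in D) F c = \bigcup_(n in choice.pickle @` D) G n.
  apply/seteqP; split => [x [c Dc Fx]|x [_ [c Dc <-]]]; last by rewrite GE => Fx; exists c.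
  by exists (choice.pickle c); [exists c|rewrite GE].
rewrite measure_bigcup; last 2 first.
- by move=> _ [c Dc <-]; rewrite GE; exact: mF.
- move=> _ _ [c Dc <-] [c' Dc' <-]; rewrite !GE => h; congr choice.pickle; exact: tF.
rewrite nneseries_esum // set_mem_set esum_image.
  by apply: eq_esum => c _; rewrite GE.
by move=> c c' _ _ /(pcan_inj choice.pickleK).
Qed.

Lemma eq_measure_mod d (T : measurableType d) (K : realType)
    (mu : {measure set T -> \bar K}) (A B N : set T) :
  measurable A -> measurable B -> mu.-negligible N ->
  (forall x, ~ N x -> A x <-> B x) -> mu A = mu B.
Proof.
move=> mA mB [N' [mN' N'0 NN']] AB.
suff le C D : measurable C -> measurable D -> (forall x, ~ N x -> C x -> D x) ->
    (mu C <= mu D)%E.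
  by apply/eqP; rewrite eq_le !le // => x /AB[].
move=> mC mD CD; rewrite -(measureU0 mD mN' N'0) le_measure ?inE //.
  exact: measurableU.
move=> x Cx; have [Nx|Nx] := pselect (N x); [right; exact: NN'|left; exact: CD].
Qed.

Section TreeWeight.
Variables (K : realType) (R : nat) (w : env K R).

Fixpoint tweight (i : int) (t : tree R) : K :=
  match t with
  | Up z => p w z.+1 i
  | Over t1 => q w i * tweight (i - 1) t1
  | Cat t1 t2 => q w i * tweight (i - 1) t1 * tweight i t2
  end.

Lemma env_ge0 i z : 0 <= val (w i) z.
Proof. by have /andP[/forallP] := valP (w i). Qed.

Lemma tweight_ge0 i t : 0 <= tweight i t.
Proof.
by elim: t i => /= [z|t IH|t1 IH1 t2 IH2] i; rewrite ?env_ge0 ?mulr_ge0 ?env_ge0.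
Qed.

Lemma jump_inj : injective (@jump R).
Proof.
move=> z z'; rewrite /jump; case: eqP => [->|_]; case: eqP => [-> //|_] //.
by move=> [e]; exact/val_inj.
Qed.

Lemma transition_jump i z : transition w i (i + jump z) = val (w i) z.
Proof.
rewrite /transition (bigD1 z) //= big1 ?addr0 // => z' /andP[/eqP e].
by rewrite (jump_inj (addrI i e)) eqxx.
Qed.

Lemma transition_down i : transition w i (i - 1) = q w i.
Proof. by rewrite -[-1]/(jump (ord0 : 'I_R.+1)) transition_jump. Qed.

Lemma transition_up i (z : 'I_R) : transition w i (i + z.+1%:Z) = p w z.+1 i.
Proof.
rewrite /p -transition_jump /jump inordK ?ltnS // ifF //.
by apply/negbTE; rewrite -val_eqE /= inordK // ltnS.
Qed.

End TreeWeight.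

Section WalkLaw.
Variables (K : realType) (R : nat) (w : env K R) (k : int).
Variable (mu : {measure set traj -> \bar K}).
Hypotheses (mu1 : mu setT = 1%E) (wlaw : walk_law w k mu).

Definition cyl (n : nat) (s : nat -> int) : set traj :=
  [set x | forall t, (t <= n)%N -> x t = s t].

Lemma measurable_cyl n s : measurable (cyl n s).
Proof. exact: meas_cyl. Qed.

Lemma cylS n s y (A : traj -> Prop) :
  [set x | cyl n s x /\ x n.+1 = y /\ A x] =
  [set x | cyl n.+1 (fun r => if r == n.+1 then y else s r) x /\ A x].
Proof.
apply/seteqP; split => x /=.
  move=> [c [e Ax]]; split => // r rn; case: eqP => [->//|ne].
  by apply: c; lia.
move=> [c Ax]; split; last by split => //; rewrite c ?eqxx.
by move=> r rn; rewrite c ?ifF //; lia.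
Qed.

Lemma mu_cylS n s y :
  mu (cyl n.+1 (fun r => if r == n.+1 then y else s r)) =
  (mu (cyl n s) * (transition w (s n) y)%:E)%E.
Proof.
have [_ /(_ n (fun r => if r == n.+1 then y else s r))] := wlaw.
rewrite eqxx ifF; last by lia.
by move=> ->; congr (mu _ * _)%E; apply/seteqP; split => x h r rn; rewrite h // ifF //; lia.
Qed.

(** Following [t] fixes every position from time n to n + [tlen t], so together with a cylinder at
    time n it is again a cylinder. The one-step Markov property then multiplies the weights, the
    second half of a [Cat] restarting from [s n]. *)
Lemma tree_cyl t n s : wf t -> exists s',
  [/\ s' (n + tlen t)%N = s n + 1 + (ttype t).1%:Z,
      [set x | cyl n s x /\ follows x n t] = cyl (n + tlen t) s' &
      mu (cyl (n + tlen t) s') = (mu (cyl n s) * (tweight w (s n) t)%:E)%E].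
Proof.
elim: t n s => /= [z|t IH|t1 IH1 t2 IH2] n s.
- move=> _; exists (fun r => if r == n.+1 then s n + z.+1%:Z else s r).
  rewrite addn1 eqxx; split; first by lia.
    have := @cylS n s (s n + z.+1%:Z) (fun=> True).
    rewrite [X in _ = X -> _](_ : _ = cyl n.+1 (fun r => if r == n.+1 then s n + z.+1%:Z else s r)).
      move=> <-; apply/seteqP; split => x /= [c]; rewrite (c n) //.
      by move=> [-> _].
    by apply/seteqP; split => x /=; [case|].
  by rewrite mu_cylS transition_up.
- move=> /andP[wt t0].
  have [s' [e1 e2 e3]] := IH n.+1 (fun r => if r == n.+1 then s n - 1 else s r) wt.
  exists s'; rewrite addnS -addSn; split.
  + by rewrite e1 eqxx; lia.
  + rewrite -e2 -cylS; apply/seteqP; split => x /= [c [-> f]]; rewrite (c n) //.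
  + by rewrite e3 eqxx mu_cylS transition_down EFinM muleA.
- move=> /and3P[w1 /eqP t10 w2].
  have [s' [e1 e2 e3]] := IH1 n.+1 (fun r => if r == n.+1 then s n - 1 else s r) w1.
  have [s'' [e1' e2' e3']] := IH2 (n.+1 + tlen t1)%N s' w2.
  have s'E : s' (n.+1 + tlen t1)%N = s n by rewrite e1 eqxx t10; lia.
  rewrite s'E in e1' e3'.
  exists s''; have -> : (n + (tlen t1 + tlen t2).+1 = n.+1 + tlen t1 + tlen t2)%N by lia.
  split => //.
  + rewrite -e2' -e2; apply/seteqP; split => x /=.
      move=> [c [xa f1 f2]]; split => //.
      have : [set x | cyl n s x /\ x n.+1 = s n - 1 /\ follows x n.+1 t1] x.
        by rewrite /= xa (c n).
      by rewrite cylS.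
    move=> [cf f2].
    have : [set x | cyl n s x /\ x n.+1 = s n - 1 /\ follows x n.+1 t1] x.
      by rewrite cylS.
    by move=> /= [c [xa f1]]; rewrite (c n).
  + by rewrite e3' e3 eqxx mu_cylS transition_down !EFinM !muleA.
Qed.

Lemma mu_tree t n s : wf t ->
  measurable [set x | cyl n s x /\ follows x n t] /\
  mu [set x | cyl n s x /\ follows x n t] = (mu (cyl n s) * (tweight w (s n) t)%:E)%E.
Proof.
by move=> /tree_cyl-/(_ n s)[s' [_ -> ->]]; split => //; exact: measurable_cyl.
Qed.

Lemma start_negligible : mu.-negligible [set x : traj | x 0%N <> k].
Proof.
have m0 := meas_coord 0 k.
apply/negligibleP; first exact: meas_not m0.
rewrite (_ : [set x : traj | _] = setT `\` [set x : traj | x 0%N = k]); last by rewrite setTD.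
rewrite measureD //=; last by rewrite mu1 ltry.
by rewrite setTI mu1 (proj1 wlaw) subee.
Qed.

Lemma inadmissible_negligible : mu.-negligible [set x | ~ admissible R x].
Proof.
(* An inadmissible path has a finite prefix whose last step is no jump. There are countably many
   such prefixes, and each cylinder is null because its transition probability is an empty sum. *)
pose bad n (s : seq int) := forall z : 'I_R.+1, nth 0 s n.+1 <> nth 0 s n + jump z.
pose F m : set traj := if choice.unpickle m is Some (n, s) then
  (if pselect (bad n s) then cyl n.+1 (nth 0 s) else set0) else set0.
apply: (@negligibleS _ _ _ _ (\bigcup_m F m)); last first.
  apply: negligible_bigcup => m; rewrite /F; case: choice.unpickle => [[n s]|];
    last exact: negligible_set0.
  case: (pselect (bad n s)) => [b|nb]; last exact: negligible_set0.
  apply/negligibleP; first exact: measurable_cyl.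
  rewrite [LHS](proj2 wlaw) /transition big1 ?mule0 // => z /eqP e.
  by exfalso; apply: (b z).
move=> x /= /existsNP[n] nz; pose s := mkseq x n.+2.
exists (choice.pickle (n, s)) => //; rewrite /F choice.pickleK; case: pselect => [b|[]].
  by move=> t tn; rewrite nth_mkseq.
by move=> z; rewrite !nth_mkseq // => e; apply: nz; exists z.
Qed.

(** This turns probabilities into sums over trees. Up to the null set N, the event is a countable
    union of the events of following a tree of [T], disjoint by [follows_inj]. *)
Lemma tree_law (T : set (tree R)) (E N : set traj) n s :
  (forall t, T t -> wf t) -> measurable E -> mu.-negligible N ->
  (forall x, ~ N x -> E x <-> exists t, [/\ T t, cyl n s x & follows x n t]) ->
  mu E = (mu (cyl n s) * \esum_(t in T) (tweight w (s n) t)%:E)%E.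
Proof.
move=> Twf mE nN EN.
have mt t : T t -> measurable [set x | cyl n s x /\ follows x n t].
  by move=> /Twf /(@mu_tree _ n s)[].
rewrite (eq_measure_mod (B := \bigcup_(t in T) [set x | cyl n s x /\ follows x n t]) mE _ nN).
- rewrite measure_bigcup_count //; last first.
    move=> t t' /Twf wt /Twf wt' [x [[_ f] [_ f']]].
    exact: follows_inj f f'.
  rewrite -ge0_esumZl //; last by move=> t _; rewrite lee_fin tweight_ge0.
  by apply: eq_esum => t /Twf /(@mu_tree _ n s)[].
- rewrite (_ : \bigcup_(t in T) _ = [set x | exists t, T t /\ (cyl n s x /\ follows x n t)]).
    apply: meas_ex => t; have [Tt|Tt] := pselect (T t).
      by apply: meas_and; [exact: meas_cst|exact: mt].
    by rewrite (_ : [set x | _] = set0) //; apply/seteqP; split => // x [].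
  by apply/seteqP; split => x [t]; [exists t|case=> ? ?; exists t].
- by move=> x /EN ->; split => [[t []]|[t Tt []]]; exists t.
Qed.

End WalkLaw.

(** * Convolution of offspring laws *)

Section Convolution.
Variables (K : realType) (R : nat).
Implicit Types (f g h : tvec R -> K) (v : tvec R).

(** A box that contains v contains all summands of v, so convolutions at v become finite sums over
    one fixed sequence, which can be exchanged freely. *)
Definition box (m : nat) : seq (tvec R) :=
  [seq \row_l (e l : nat)
  | e : {ffun 'I_(ntypes R) -> 'I_m.+1} <- enum {: {ffun 'I_(ntypes R) -> 'I_m.+1}}].

Lemma box_uniq m : uniq (box m).
Proof.
rewrite map_inj_uniq ?enum_uniq // => e e' /rowP ee'.
by apply/ffunP => l; apply/val_inj; have := ee' l; rewrite !mxE.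
Qed.

Lemma mem_box m v : (v \in box m) = [forall l, v ord0 l <= m]%N.
Proof.
apply/mapP/forallP => [[e _ ->] l|vm]; first by rewrite mxE -ltnS.
exists [ffun l => inord (v ord0 l)]; first by rewrite mem_enum.
 apply/rowP => l.
by rewrite mxE ffunE inordK // ltnS.
Qed.

Lemma box_addP m (a b : tvec R) : a + b \in box m -> a \in box m /\ b \in box m.
Proof.
rewrite !mem_box => /forallP h.
split; apply/forallP => l; apply: leq_trans (h l); rewrite mxE; first exact: leq_addr.
exact: leq_addl.
Qed.

Lemma splits_finite v : finite_set [set ab : tvec R * tvec R | ab.1 + ab.2 = v].
Proof.
pose m := vsize v.
have vb : v \in box m.
  by rewrite mem_box; apply/forallP => l; rewrite /m /vsize (bigD1 l) //= leq_addr.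
apply: (@sub_finite_set _ _ [set` [seq (a, b) | a <- box m, b <- box m]]); last exact: finite_seq.
move=> [a b] /= abv; apply/allpairsP; exists (a, b) => /=.
by rewrite -abv in vb; case: (box_addP vb).
Qed.

Lemma conv_box f g m v : v \in box m ->
  conv_pmf f g v = \sum_(a <- box m) \sum_(b <- box m | a + b == v) f a * g b.
Proof.
move=> vb; rewrite /conv_pmf.
rewrite (fsbigE [seq ab <- [seq (a, b) | a <- box m, b <- box m] | ab.1 + ab.2 == v]).
- rewrite big_filter_cond big_mkcond big_allpairs; apply: eq_bigr => a _.
  rewrite [RHS]big_mkcond; apply: eq_bigr => b _ /=; case: eqP => //= e.
  by rewrite mem_set.
- by rewrite filter_uniq // allpairs_uniq ?box_uniq // => -[? ?] [? ?].
- by move=> ab /=; rewrite mem_filter => /andP[/eqP].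
- move=> [a b] /= abv; rewrite mem_filter /= abv eqxx /= => /allpairsP[]; exists (a, b) => /=.
  by rewrite -abv in vb; case: (box_addP vb).
Qed.

Lemma conv_pmfC : commutative (@conv_pmf K R).
Proof.
move=> f g; apply/funext => v; rewrite /conv_pmf.
rewrite (reindex_fsbig (fun ab => (ab.2, ab.1)) [set ab | ab.1 + ab.2 = v]).
  by apply: eq_fsbigr => -[a b] _; rewrite /= mulrC.
split => [[a b] /= <-|[a b] [a' b'] _ _ /= [-> ->]|[a b] /= <-] //; first exact: addrC.
by exists (b, a) => //=; rewrite addrC.
Qed.

Lemma conv_pmf0f : left_id (@pmf0 K R) (@conv_pmf K R).
Proof.
move=> f; apply/funext => v; rewrite /conv_pmf.
rewrite (fsbigD1 (0, v)) /=; [|exact: splits_finite|by rewrite add0r].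
rewrite /pmf0 eqxx mul1r fsbig1 ?addr0 // => -[a b] /= [abv ne].
case: eqP => [a0|]; last by rewrite mul0r.
by exfalso; apply: ne; rewrite -abv a0 add0r.
Qed.

Lemma conv_pmfA : associative (@conv_pmf K R).
Proof.
have box3 f g h m v : v \in box m -> conv_pmf f (conv_pmf g h) v =
   \sum_(a <- box m) \sum_(b <- box m) \sum_(c <- box m)
     if a + b + c == v then f a * g b * h c else 0.
  move=> vb; rewrite (conv_box _ _ vb); apply: eq_bigr => a _.
  transitivity (\sum_(p <- box m | a + p == v) \sum_(b <- box m) \sum_(c <- box m)
     if b + c == p then f a * g b * h c else 0).
    rewrite big_seq_cond [RHS]big_seq_cond; apply: eq_bigr => p /andP[pb _].
    rewrite (conv_box _ _ pb) big_distrr; apply: eq_bigr => b _.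
    by rewrite -big_mkcond big_distrr; apply: eq_bigr => c _ /=; exact: mulrA.
  rewrite exchange_big; apply: eq_bigr => b _; rewrite exchange_big /=.
  apply: eq_bigr => c _; case: ifPn => [/eqP abc|abc].
    have bcb : b + c \in box m by rewrite -abc -addrA in vb; case: (box_addP vb).
    rewrite big_mkcond (bigD1_seq (b + c)) ?box_uniq //= addrA abc !eqxx.
    by rewrite big1 ?addr0 // => p ne; rewrite [_ == p]eq_sym (negbTE ne) if_same.
  rewrite big1 // => p /eqP ap; case: eqP => // bcp.
  by rewrite -ap -bcp addrA eqxx in abc.
move=> f g h; apply/funext => v; pose m := vsize v.
have vb : v \in box m.
  by rewrite mem_box; apply/forallP => l; rewrite /m /vsize (bigD1 l) //= leq_addr.
(* By commutativity the other bracketing is h convolved with the convolution of f and g, so [box3]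
   applies to it too and only the order of summation differs. *)
rewrite (box3 _ _ _ _ _ vb) conv_pmfC (box3 _ _ _ _ _ vb).
rewrite [RHS]exchange_big; apply: eq_bigr => a _ /=.
rewrite [RHS]exchange_big; apply: eq_bigr => b _ /=; apply: eq_bigr => c _.
by rewrite -(addrA c) (addrC c); case: eqP => // _; rewrite mulrC mulrA.
Qed.

End Convolution.
HB.instance Definition _ (K : realType) (R : nat) :=
  Monoid.isComLaw.Build (tvec R -> K) (@pmf0 K R) (@conv_pmf K R)
    (@conv_pmfA K R) (@conv_pmfC K R) (@conv_pmf0f K R).

Definition evec_ord R (l : 'I_(ntypes R)) : tvec R := \row_l' (l' == l : nat).

Lemma evec_ordE R (l : 'I_(ntypes R)) : evec R l.+1 = evec_ord l.
Proof. by apply/rowP => l'; rewrite !mxE eqSS. Qed.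

Section OffspringSum.
Variables (K : realType) (R : nat).
Implicit Types (f : 'I_(ntypes R) -> tvec R -> K) (u v : tvec R).

Lemma offspring_sum0 f : offspring_sum f 0 = @pmf0 K R.
Proof. by rewrite /offspring_sum big1 // => k _; rewrite mxE. Qed.

(** Branching property in one generation: disjoint subpopulations have independent offspring. *)
Lemma offspring_sumD f u u' :
  offspring_sum f (u + u') = conv_pmf (offspring_sum f u) (offspring_sum f u').
Proof.
rewrite /offspring_sum -big_split; apply: eq_bigr => k _ /=.
rewrite mxE iterD; elim: (u ord0 k) => [|n IH] /=; first by rewrite conv_pmf0f.
by rewrite IH conv_pmfA.
Qed.

Lemma offspring_sum1 f l : offspring_sum f (evec_ord l) = f l.
Proof.
rewrite /offspring_sum (bigD1 l) //= big1 => [|k /negbTE kl]; last by rewrite mxE kl.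
by rewrite mxE eqxx /= conv_pmfC conv_pmf0f conv_pmfC conv_pmf0f.
Qed.

Lemma conv_pmf_ge0 (f g : tvec R -> K) :
  (forall v, 0 <= f v) -> (forall v, 0 <= g v) -> forall v, 0 <= conv_pmf f g v.
Proof. by move=> f0 g0 v; apply: fsumr_ge0 => ab _; rewrite mulr_ge0. Qed.

Lemma offspring_sum_ge0 f u v :
  (forall l v, 0 <= f l v) -> 0 <= offspring_sum f u v.
Proof.
move=> f0; rewrite /offspring_sum.
have p0 : forall v, 0 <= @pmf0 K R v by move=> ?; rewrite /pmf0 ler0n.
move: v; apply: (big_ind (fun g : tvec R -> K => forall v, 0 <= g v)) => // [? ? ? ?|k _];
  first exact: conv_pmf_ge0.
by elim: (u ord0 k) => //= n IH; apply: conv_pmf_ge0.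
Qed.

Lemma conv_pmf_esum (f g : tvec R -> K) v :
  (forall v, 0 <= f v) -> (forall v, 0 <= g v) ->
  (\esum_(ab in [set ab | (ab.1 + ab.2)%R = v]) ((f ab.1)%:E * (g ab.2)%:E) =
   (conv_pmf f g v)%:E)%E.
Proof.
move=> f0 g0; rewrite esum_fset; last 2 first.
- exact: splits_finite.
- by move=> ab _; rewrite mule_ge0 ?lee_fin.
rewrite /conv_pmf -fsumEFin; last exact: splits_finite.
by apply: eq_fsbigr => ab _; rewrite EFinM.
Qed.

End OffspringSum.

(** * Laws of several successive generations *)

Section Generations.
Variables (K : realType) (R : nat) (off : int -> 'I_(ntypes R) -> tvec R -> K).
Hypothesis off_ge0 : forall i l v, 0 <= off i l v.
Local Open Scope ereal_scope.

(* Probability that u particles of generation V (i + 1) have descendants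
   v_0, v_1, ... in the generations V i, V (i - 1), ... *)
Fixpoint lineage (i : int) (u : tvec R) (vs : seq (tvec R)) : K :=
  if vs is v :: vs' then (offspring_sum (off i) u v * lineage (i - 1) v vs')%R
  else 1%R.

Lemma lineage_ge0 i u vs : (0 <= lineage i u vs)%R.
Proof.
elim: vs i u => //= v vs IH i u; rewrite mulr_ge0 //.
by apply: offspring_sum_ge0.
Qed.

(** The Markov property of the chain appends a generation at the end, whereas [lineage] recurses
    from the front. *)
Lemma lineage_rcons i u vs v :
  lineage i u (rcons vs v) =
  (lineage i u vs * offspring_sum (off (i - (size vs)%:Z)) (last u vs) v)%R.
Proof.
elim: vs i u => [|v' vs IH] i u /=; first by rewrite subr0 mulr1 mul1r.
by rewrite IH mulrA -addrA -opprD.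
Qed.

Lemma lineage0 i vs : lineage i 0%R vs = (all (pred1 0%R) vs)%:R.
Proof.
elim: vs i => //= v vs IH i; rewrite offspring_sum0 /pmf0.
by case: eqP => [->|_]; rewrite ?mul0r //= IH mul1r.
Qed.

Definition zip_add (a b : seq (tvec R)) : seq (tvec R) :=
  [seq (x.1 + x.2)%R | x <- zip a b].

(** The sizes must be required equal because [zip] truncates to the shorter list. *)
Definition splits (vs : seq (tvec R)) : set (seq (tvec R) * seq (tvec R)) :=
  [set ab | size ab.1 = size ab.2 /\ zip_add ab.1 ab.2 = vs].

(** Branching property over several generations. Splitting off the first entries gives the
    convolution of [offspring_sumD]; for each a + b = v, the induction hypothesis sums the remaining
    entries. *)
Lemma lineage_splits i u u' vs :
  \esum_(ab in splits vs) ((lineage i u ab.1)%:E * (lineage i u' ab.2)%:E) =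
  (lineage i (u + u')%R vs)%:E.
Proof.
elim: vs i u u' => [|v vs IH] i u u'.
  rewrite (_ : splits [::] = [set ([::], [::])]) ?esum_set1 ?mule1 //.
  by apply/seteqP; split => [[[|? ?] [|? ?]] [/= ? ?]|_ ->] //.
have bij : set_bij ([set ab : tvec R * tvec R | (ab.1 + ab.2)%R = v] `*`` (fun=> splits vs))
    (splits (v :: vs)) (fun x => (x.1.1 :: x.2.1, x.1.2 :: x.2.2)).
  split.
  - by move=> [[a b] [as' bs]] /= [/= <- [/= sab <-]]; split => //=; rewrite sab.
  - move=> [[a b] [as' bs]] [[a1 b1] [as1 bs1]] _ _ /=.
    by move=> [-> -> -> ->].
  - move=> [[|a as'] [|b bs]] [/= // [sab] [<- <-]].
    by exists ((a, b), (as', bs)).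
rewrite (reindex_esum _ _ _ _ bij)
  -(esum_esum (a := fun x y => (lineage i u (x.1 :: y.1))%:E *
                              (lineage i u' (x.2 :: y.2))%:E)); last first.
  by move=> x y _ _; rewrite mule_ge0 ?lee_fin ?lineage_ge0.
rewrite /= EFinM offspring_sumD -conv_pmf_esum; last 2 first.
- by move=> ?; exact: offspring_sum_ge0.
- by move=> ?; exact: offspring_sum_ge0.
rewrite -ge0_esumZr ?lee_fin ?lineage_ge0 //; last first.
  by move=> ab _; rewrite mule_ge0 ?lee_fin ?offspring_sum_ge0.
apply: eq_esum => -[a b] /= abv.
rewrite -abv -IH -ge0_esumZl; last 2 first.
- by rewrite mule_ge0 ?lee_fin ?offspring_sum_ge0.
- by move=> ab _; rewrite mule_ge0 ?lee_fin ?lineage_ge0.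
by apply: eq_esum => ab _; rewrite !EFinM muleACA.
Qed.

End Generations.

(** * Multinomial weights *)

Section VectorSub.
Variable R : nat.
Implicit Types (u v d : tvec R) (l : 'I_(ntypes R)).

Definition vle d v := [forall l, d ord0 l <= v ord0 l]%N.

Definition vsub v d : tvec R := \row_l (v ord0 l - d ord0 l)%N.

Lemma vaddE u v l : (u + v) ord0 l = (u ord0 l + v ord0 l)%N.
Proof. by rewrite mxE. Qed.

Lemma vsubK d v : vle d v -> d + vsub v d = v.
Proof. by move=> /forallP dv; apply/rowP => l; rewrite vaddE mxE subnKC. Qed.

Lemma vle_add d v : vle d (d + v).
Proof. by apply/forallP => l; rewrite vaddE leq_addr. Qed.

Lemma vaddK d v : vsub (d + v) d = v.
Proof. by apply/rowP => l; rewrite mxE vaddE addKn. Qed.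

Lemma vaddI d u v : d + u = d + v -> u = v.
Proof. by move=> /(congr1 (vsub^~ d)); rewrite !vaddK. Qed.

Lemma vle_evec l v : vle (evec_ord l) v = (0 < v ord0 l)%N.
Proof.
apply/forallP/idP => [/(_ l)|vl l']; first by rewrite mxE eqxx.
by rewrite mxE; case: eqP => // ->.
Qed.

Lemma vsize0 : vsize (0 : tvec R) = 0%N.
Proof. by rewrite /vsize big1 // => l _; rewrite mxE. Qed.

Lemma vsizeD u v : vsize (u + v) = (vsize u + vsize v)%N.
Proof. by rewrite /vsize -big_split; apply: eq_bigr => l _; rewrite vaddE. Qed.

Lemma vsize_evec l : vsize (evec_ord l) = 1%N.
Proof.
rewrite /vsize (bigD1 l) //= mxE eqxx big1 // => l' /negbTE ll'.
by rewrite mxE ll'.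
Qed.

Lemma vsize_eq0 v : (vsize v == 0%N) = (v == 0).
Proof.
apply/eqP/eqP => [|->]; last exact: vsize0.
move=> v0; apply/rowP => l; rewrite mxE; apply/eqP; rewrite -leqn0.
apply: (@leq_trans (vsize v)); last by rewrite v0.
by rewrite /vsize (bigD1 l) //= leq_addr.
Qed.

End VectorSub.

Section Weights.
Variables (K : realType) (R : nat) (a : 'I_(ntypes R) -> K).
Hypothesis a_ge0 : forall l, 0 <= a l.
Implicit Types (u v d : tvec R) (l : 'I_(ntypes R)).

(** The total weight of the words that contain each letter l exactly v_l times, letter l having
    weight [a l]; words stand for sequences of loops. *)
Definition mweight v : K :=
  (vsize v)`!%:R / (\prod_l (v ord0 l)`!)%N%:R * \prod_l a l ^+ v ord0 l.

Lemma mweight_ge0 v : 0 <= mweight v.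
Proof.
rewrite /mweight mulr_ge0 ?divr_ge0 ?ler0n //.
by apply: prodr_ge0 => l _; rewrite exprn_ge0.
Qed.

Lemma mweight0 : mweight 0 = 1.
Proof.
rewrite /mweight vsize0 !big1 ?divr1 ?mulr1 // => l _; by rewrite mxE.
Qed.

(** Among the words counted by v, the proportion v_l / |v| begins with l. Writing v as e_l + v'
    removes the subtraction and leaves a field identity. *)
Lemma mweight_step v l : (0 < v ord0 l)%N ->
  a l * mweight (vsub v (evec_ord l)) = mweight v * ((v ord0 l)%:R / (vsize v)%:R).
Proof.
move=> vl; have vK : evec_ord l + vsub v (evec_ord l) = v by rewrite vsubK ?vle_evec.
move: (vsub _ _) vK => v' <- {v vl}.
rewrite /mweight vsizeD vsize_evec vaddE mxE eqxx add1n.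
have fE : (\prod_l' ((evec_ord l + v')%R ord0 l')`! =
           (v' ord0 l).+1 * \prod_l' (v' ord0 l')`!)%N.
  rewrite (bigD1 l) //= [in RHS](bigD1 l) //= vaddE mxE eqxx add1n factS mulnA.
  congr (_ * _)%N; apply: eq_bigr => l' /negbTE ll'.
  by rewrite vaddE mxE ll'.
have pE : \prod_l' a l' ^+ (evec_ord l + v')%R ord0 l' = a l * \prod_l' a l' ^+ v' ord0 l'.
  rewrite (bigD1 l) //= [in RHS](bigD1 l) //= vaddE mxE eqxx add1n exprS mulrA.
  congr (_ * _); apply: eq_bigr => l' /negbTE ll'.
  by rewrite vaddE mxE ll'.
rewrite fE pE factS !natrM.
have f0 : (\prod_l' (v' ord0 l')`!)%N%:R != 0 :> K.
  by rewrite pnatr_eq0 -lt0n prodn_gt0 // => l'; rewrite fact_gt0.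
have n1 : (vsize v').+1%:R != 0 :> K by rewrite pnatr_eq0.
have n2 : (v' ord0 l).+1%:R != 0 :> K by rewrite pnatr_eq0.
change (true + v' ord0 l)%N with (v' ord0 l).+1.
move: f0 n1 n2; move: ((vsize v').+1%:R : K) ((v' ord0 l).+1%:R : K).
move: ((\prod_l' (v' ord0 l')`!)%N%:R : K) => z x y z0 x0 y0.
by field; rewrite x0 y0 z0.
Qed.

(* Obtained by distinguishing the type of the first of the |v| loops. *)
Lemma mweight_rec v : mweight v =
  (v == 0)%:R + \sum_l (if (0 < v ord0 l)%N
                        then a l * mweight (vsub v (evec_ord l)) else 0).
Proof.
case: eqP => [->|/eqP v0].
  by rewrite mweight0 big1 ?addr0 // => l _; rewrite mxE.
rewrite add0r (eq_bigr (fun l => mweight v * ((v ord0 l)%:R / (vsize v)%:R))); last first.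
  move=> l _; case: ifPn => [/mweight_step //|]; rewrite -eqn0Ngt => /eqP ->.
  by rewrite mul0r mulr0.
rewrite -big_distrr -big_distrl /= -natr_sum divff ?mulr1 //.
by rewrite pnatr_eq0 vsize_eq0.
Qed.

(** The particles of d are imposed and only the remainder v - d consists of free loops. *)
Definition mweight_above d v : K := if vle d v then mweight (vsub v d) else 0.

Lemma mweight_above_ge0 d v : 0 <= mweight_above d v.
Proof. by rewrite /mweight_above; case: ifP => // _; exact: mweight_ge0. Qed.

Lemma mweight_above_rec d v : mweight_above d v =
  (v == d)%:R + \sum_l (if (0 < v ord0 l)%N
                 then a l * mweight_above d (vsub v (evec_ord l)) else 0).
Proof.
rewrite /mweight_above; case: ifPn => [dv|dv].
  rewrite -[in RHS](vsubK dv); move: (vsub v d) => {dv}v.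
  rewrite mweight_rec.
  congr (_%:R + _); first by congr nat_of_bool; apply/eqP/eqP => [->|e];
    [rewrite addr0|apply: (@vaddI _ d); rewrite addr0].
  apply: eq_bigr => l _; rewrite vaddE; have [vl|vl] := posnP (v ord0 l).
    (* If v contains no l, every l in d + v comes from d, and removing one leaves a vector no longer
       above d. *)
    rewrite vl addn0; case: ifPn => // dl; rewrite ifF ?mulr0 //.
    apply/negbTE/negP => /forallP/(_ l); rewrite [vsub _ _ _ _]mxE vaddE vl addn0.
    by rewrite mxE eqxx; move: dl => /=; lia.
  rewrite addn_gt0 vl orbT.
  have -> : vsub (d + v) (evec_ord l) = d + vsub v (evec_ord l).
    apply: (@vaddI _ (evec_ord l)); rewrite addrCA !vsubK ?vle_evec //.
    by rewrite vaddE addn_gt0 vl orbT.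
  by rewrite vle_add vaddK.
rewrite (_ : v == d = false) ?big1 ?addr0 //.
  move=> l _; case: ifPn => // vl; rewrite ifF ?mulr0 //.
  apply: contraNF dv => /forallP h; apply/forallP => l'.
  by apply: leq_trans (h l') _; rewrite mxE leq_subr.
by apply: contraNF dv => /eqP ->; apply/forallP => l.
Qed.

Local Open Scope ereal_scope.

(** The recursion on the first loop, summed against [phi]: adding e_l maps B' bijectively onto the
    vectors of B with positive coordinate l. It is used with both sets full, for fixed-point
    equations, and with successive levels, for bounds. *)
Lemma mweight_esum (B B' : set (tvec R)) (phi : tvec R -> K) :
  B 0%R -> (forall l v, B (evec_ord l + v)%R <-> B' v) -> (forall v, 0 <= phi v)%R ->
  \esum_(v in B) (phi v * mweight v)%:E = (phi 0%R)%:E +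
    \sum_l (a l)%:E * \esum_(v in B') (phi (evec_ord l + v)%R * mweight v)%:E.
Proof.
move=> B0 BB' phi0.
have p0 (u v : tvec R) : 0 <= (phi u * mweight v)%:E.
  by rewrite lee_fin mulr_ge0 ?mweight_ge0.
transitivity (\esum_(v in B) ((phi v * (v == 0)%:R)%:E +
    \sum_l (if (0 < v ord0 l)%N then
      (a l)%:E * (phi v * mweight (vsub v (evec_ord l)))%:E else 0))).
  apply: eq_esum => v _; rewrite mweight_rec mulrDr EFinD; congr (_ + _).
  rewrite big_distrr /= -sumEFin; apply: eq_bigr => l _; case: ifP => _; last by rewrite mulr0.
  by rewrite -EFinM mulrCA.
rewrite esumD; last 2 first.
- by move=> v _; rewrite lee_fin mulr_ge0 ?ler0n.
- by move=> v _; apply: sume_ge0 => l _; case: ifP => // _; apply: mule_ge0 => //;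
    rewrite lee_fin a_ge0.
congr (_ + _).
  rewrite (esumID [set 0%R]); last by move=> v _; rewrite lee_fin mulr_ge0 ?ler0n.
  rewrite [X in _ + X]esum1 => [|v [_ /eqP/negbTE /= ->]]; last by rewrite mulr0.
  rewrite (_ : B `&` [set 0%R] = [set 0%R]) ?esum_set1 ?eqxx ?mulr1 ?adde0 ?lee_fin //.
  by apply/seteqP; split => v /=; [case|move=> ->].
rewrite esum_sum; last first.
  by move=> v l _ _; case: ifP => // _; apply: mule_ge0 => //; rewrite lee_fin a_ge0.
apply: eq_bigr => l _; rewrite -ge0_esumZl ?lee_fin ?a_ge0 //.
have bij : set_bij B' (B `&` [set v | (0 < v ord0 l)%N]) (fun v => (evec_ord l + v)%R).
  split.
  - by move=> v /(BB' l) Bv; split => //=; rewrite vaddE mxE eqxx.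
  - by move=> u v _ _; exact: vaddI.
  - move=> v [Bv vl]; have vK : (evec_ord l + vsub v (evec_ord l))%R = v by rewrite vsubK ?vle_evec.
    by exists (vsub v (evec_ord l)) => //; apply/(BB' l); rewrite vK.
transitivity (\esum_(v in B `&` [set v : tvec R | (0 < v ord0 l)%N])
   ((a l)%:E * (phi v * mweight (vsub v (evec_ord l)))%:E)).
  rewrite esum_mkcondr; apply: eq_esum => v _.
  by rewrite (_ : (v \in [set v : tvec R | (0 < v ord0 l)%N]) = (0 < v ord0 l)%N) //;
    apply/idP/idP => [/set_mem|/mem_set].
by rewrite (reindex_esum _ _ _ _ bij); apply: eq_esum => v _; rewrite vaddK.
Qed.

Lemma esum_mweight_above d (phi : tvec R -> K) : (forall v, 0 <= phi v)%R ->
  \esum_(v in [set: tvec R]) (phi v * mweight_above d v)%:E =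
  \esum_(v in [set: tvec R]) (phi (d + v)%R * mweight v)%:E.
Proof.
move=> phi0; rewrite (esumID [set v | vle d v]); last first.
  by move=> v _; rewrite lee_fin mulr_ge0 ?mweight_above_ge0.
rewrite [X in _ + X]esum1 ?adde0 => [|v [_ /= /negP/negbTE dv]]; last first.
  by rewrite /mweight_above dv mulr0.
have bij : set_bij [set: tvec R] (setT `&` [set v | vle d v]) (fun v => d + v)%R.
  split=> [v _|u v _ _|v [_ /= dv]]; [by split => //=; exact: vle_add|exact: vaddI|].
  by exists (vsub v d); rewrite ?vsubK.
rewrite (reindex_esum _ _ _ _ bij); apply: eq_esum => v _.
by rewrite /mweight_above vle_add vaddK.
Qed.

(** * Total mass and mean of the multinomial weights *)

Lemma esum_le_levels (f : tvec R -> \bar K) (c : \bar K) : (forall v, 0 <= f v) ->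
  (forall N, \esum_(v in [set v | (vsize v <= N)%N]) f v <= c) ->
  \esum_(v in [set: tvec R]) f v <= c.
Proof.
move=> f0 fc; apply: ge_ereal_sup => _ [X [finX _] <-].
pose N := (\max_(v <- fset_set X) vsize v)%N.
apply: le_trans (fc N); apply: esum_ge; exists X => //; split => // v Xv /=.
by apply: leq_bigmax_seq => //; rewrite in_fset_set // inE.
Qed.

Hypothesis sum_a_lt1 : (\sum_l a l < 1)%R.
Let s := (\sum_l a l)%R.

Let s1 : (1 - s != 0)%R. Proof. by rewrite subr_eq0 gt_eqF. Qed.
Let s1_gt0 : (0 < 1 - s)%R. Proof. by rewrite subr_gt0. Qed.

Let levelS l v N : [set v | (vsize v <= N.+1)%N] (evec_ord l + v)%R <->
  [set v | (vsize v <= N)%N] v.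
Proof. by rewrite /= vsizeD vsize_evec. Qed.

(** The bound by [c] rules out +oo, after which the equation is linear in a real unknown. *)
Let fixed_point (x : \bar K) (b c : K) : 0 <= x -> x <= c%:E ->
  x = b%:E + s%:E * x -> x = (b / (1 - s))%:E.
Proof.
case: x => [x| |] // _ _; rewrite -EFinM -EFinD => -[e]; congr _%:E.
by apply: (mulIf s1); rewrite divfK // mulrBr mulr1 {1}e; ring.
Qed.

Let level0 (phi : tvec R -> K) : (0 <= phi 0)%R ->
  \esum_(v in [set v | (vsize v <= 0)%N]) (phi v * mweight v)%:E = (phi 0%R)%:E.
Proof.
move=> p0; rewrite (_ : [set v | _] = [set 0%R]) ?esum_set1 ?mweight0 ?mulr1 ?lee_fin //.
by apply/seteqP; split => v /=; rewrite leqn0 vsize_eq0 => /eqP.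
Qed.

(** All words together form a geometric series, evaluated as the fixed point of x = 1 + s x. The
    value c = 1 / (1 - s) satisfies c = 1 + s c, so by induction it bounds the sum over each level,
    which gives finiteness. *)
Lemma esum_mweight : \esum_(v in [set: tvec R]) (mweight v)%:E = (1 / (1 - s))%:E.
Proof.
have E (B B' : set (tvec R)) : B 0%R -> (forall l v, B (evec_ord l + v)%R <-> B' v) ->
    \esum_(v in B) (mweight v)%:E = 1 + s%:E * \esum_(v in B') (mweight v)%:E.
  move=> B0 BB'; have := mweight_esum B0 BB' (phi := fun=> 1%R) (fun=> ler01).
  under eq_esum do rewrite mul1r; move=> ->; congr (_ + _).
  rewrite /s -sumEFin ge0_sume_distrl; last by move=> l _; rewrite lee_fin.
  by apply: eq_bigr => l _; congr (_ * _); apply: eq_esum => v _; rewrite mul1r.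
apply: (@fixed_point _ _ (1 / (1 - s))%R); last exact: E.
  by apply: esum_ge0 => v _; rewrite lee_fin mweight_ge0.
apply: esum_le_levels => [v|N]; first by rewrite lee_fin mweight_ge0.
have cE : (1 / (1 - s) = 1 + s * (1 / (1 - s)))%R by field.
elim: N => [|N IH].
  have := @level0 (fun=> 1%R) ler01; under eq_esum do rewrite mul1r; move=> ->.
  by rewrite lee_fin ler_pdivlMr // mul1r lerBlDl lerDr sumr_ge0.
have -> : (1 / (1 - s))%:E = 1 + s%:E * (1 / (1 - s))%:E by rewrite {1}cE EFinD EFinM.
rewrite (E _ _ _ (fun l v => levelS l v N)); last by rewrite /= vsize0.
by rewrite leeD2l // lee_wpmul2l // lee_fin sumr_ge0.
Qed.

(** Removing the first loop lowers v_l by one exactly when that loop is of type l. The mean x thus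
    solves x = a_l / (1 - s) + s x, and is bounded level by level in the same way. *)
Lemma esum_mweight_mean l :
  \esum_(v in [set: tvec R]) ((v ord0 l)%:R * mweight v)%:E = (a l / (1 - s) / (1 - s))%:E.
Proof.
pose m (B : set (tvec R)) := \esum_(v in B) ((v ord0 l)%:R * mweight v)%:E.
have m0 (v : tvec R) : 0 <= ((v ord0 l)%:R * mweight v)%:E.
  by rewrite lee_fin mulr_ge0 ?mweight_ge0.
have E (B B' : set (tvec R)) : B 0%R -> (forall l v, B (evec_ord l + v)%R <-> B' v) ->
    m B = (a l)%:E * (\esum_(v in B') (mweight v)%:E) + s%:E * m B'.
  move=> B0 BB'; rewrite /m (mweight_esum B0 BB' (phi := fun v => (v ord0 l)%:R)) //.
  rewrite mxE add0e.
  have M0 : 0 <= \esum_(v in B') (mweight v)%:E.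
    by apply: esum_ge0 => v _; rewrite lee_fin mweight_ge0.
  have mB0 : 0 <= m B' by apply: esum_ge0.
  transitivity (\sum_l' ((a l' * (l == l')%:R)%:E * (\esum_(v in B') (mweight v)%:E) +
                   (a l')%:E * m B')).
    apply: eq_bigr => l' _; rewrite EFinM -muleA -ge0_muleDr //; last first.
      by rewrite mule_ge0 ?lee_fin ?ler0n.
    congr (_ * _); rewrite -ge0_esumZl ?lee_fin ?ler0n //; last first.
      by move=> v _; rewrite lee_fin mweight_ge0.
    rewrite -esumD //; last by move=> v _; rewrite mule_ge0 ?lee_fin ?ler0n ?mweight_ge0.
    by apply: eq_esum => v _; rewrite vaddE mxE natrD mulrDl EFinD EFinM.
  rewrite big_split /= -ge0_sume_distrl; last first.
    by move=> l' _; rewrite lee_fin mulr_ge0 ?ler0n.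
  rewrite -ge0_sume_distrl; last by move=> l' _; rewrite lee_fin.
  rewrite !sumEFin (bigD1 l) //= eqxx mulr1 big1 ?addr0 // => l' /negbTE ll'.
  by rewrite eq_sym ll' mulr0.
have C0 : (0 <= a l / (1 - s) / (1 - s))%R by rewrite !divr_ge0 // ltW.
apply: (@fixed_point _ (a l / (1 - s))%R (a l / (1 - s) / (1 - s))%R).
- exact: esum_ge0.
- apply: esum_le_levels => // N.
  have cE : (a l / (1 - s) / (1 - s) = a l * (1 / (1 - s)) + s * (a l / (1 - s) / (1 - s)))%R.
    by field.
  elim: N => [|N IH].
    by rewrite (@level0 (fun v => (v ord0 l)%:R)) ?mxE ?lee_fin // ler0n.
  rewrite -/(m _) (E _ _ _ (fun l v => levelS l v N)); last by rewrite /= vsize0.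
  rewrite [in leRHS]cE EFinD (EFinM (a l)) (EFinM s).
  apply: leeD; apply: lee_wpmul2l; rewrite ?lee_fin ?sumr_ge0 //.
  rewrite -esum_mweight; apply: ge_ereal_sup => _ [X [finX _] <-].
  by apply: esum_ge; exists X.
- by rewrite -/(m _) {1}(E _ setT) // esum_mweight -EFinM mulrA mulr1.
Qed.

End Weights.

(** * Sums over trees *)

Lemma esum_fintype (K : realType) (I : finType) (P : pred I) (f : I -> \bar K) :
  (forall i, 0 <= f i)%E -> (\esum_(i in [set i | P i]) f i = \sum_(i | P i) f i)%E.
Proof.
move=> f0; rewrite esum_fset //; last exact: finite_finset.
by rewrite (@bigfs _ _ _ _ (index_enum I)) ?index_enum_uniq // => i _; rewrite mem_index_enum.
Qed.

Lemma mkseq_cst (T : eqType) (c : T) n : mkseq (fun=> c) n = nseq n c.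
Proof.
by apply: (@eq_from_nth _ c) => [|k]; rewrite size_mkseq ?size_nseq // => kn;
  rewrite nth_mkseq // nth_nseq kn.
Qed.

Section TreeSums.
Variables (K : realType) (R : nat) (w : env K R).
Implicit Types (t : tree R) (tau : nat * nat) (v : tvec R) (vs ws : seq (tvec R)) (i : int).

Definition tcnts n t : seq (tvec R) := mkseq (tcnt t) n.

Definition typed tau : set (tree R) := [set t | wf t /\ ttype t = tau].

(** The quantity H(i, k, vs), the type k being given by its pair [tau]. *)
Definition tree_sum i tau vs : \bar K :=
  (\esum_(t in [set t | typed tau t /\ tcnts (size vs) t = vs]) (tweight w i t)%:E)%E.

Definition ladder_mass i tau : K := fine (tree_sum i tau [::]).

(** The expression of p_(k)(i) through trees; the two are identified in [pcrossE]. *)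
Definition down_weight i tau : K := q w i * ladder_mass (i - 1) tau.

(* Types beyond R cross back above level i and get weight 0, so that
   mweight (loop_weight i) vanishes off the span of e_1, ..., e_R. *)
Definition loop_weight i (l : 'I_(ntypes R)) : K :=
  if (l < R)%N then down_weight i (0%N, l.+1) else 0.

(** The weight c(i, k). For m = 1 the last jump leaves from i itself. For m >= 2 it goes from i - (m
    - 1) to i + (j + 1), so it ends an excursion of type (j + 1, m - 1) below i. *)
Definition exit_weight i tau : K :=
  if tau.2 == 1%N then p w tau.1.+1 i else down_weight i (tau.1.+1, tau.2.-1).

(* A segment of type (j, m) with m >= 2 leaves its starting level by a down-step
   of type (j + 1, m - 1), which is counted together with its loops. *)
Definition exit_vec tau : tvec R :=
  if tau.2 == 1%N then 0 else evec R (kappa R tau.1.+1 tau.2.-1).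

(** [exit_vec] indexed by the type number, in the form used by [mean_matrix] for the columns beyond
    R. *)
Definition exit_vec_ord (k : 'I_(ntypes R)) : tvec R :=
  \row_l (`[< exists j m, [/\ (j + 2 <= R)%N, (2 <= m <= R - j)%N,
            k.+1 = kappa R j m & l.+1 = kappa R j.+1 m.-1] >] : nat).

(** The imposed vector d_k plus a random number of loops: before each one the sequence stops with
    probability one minus the total loop weight. *)
Definition offspring_law i k v : K :=
  (1 - \sum_l loop_weight i l) * mweight_above (loop_weight i) (exit_vec_ord k) v.

Lemma exit_vec_ordE (k : 'I_(ntypes R)) j m : type_pair R j m -> k.+1 = kappa R j m ->
  exit_vec_ord k = exit_vec (j, m).
Proof.
move=> jm kE; rewrite /exit_vec /=; case: eqP => [m1|m1].
  apply/rowP => l; rewrite !mxE asboolF // => -[j' [m' [h1 h2]]].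
  rewrite kE => /kappa_inj-/(_ jm)[|_ e]; last by move: h2; rewrite -e m1.
  by rewrite /type_pair; move: h1 h2; lia.
apply/rowP => l; rewrite !mxE; congr nat_of_bool; apply/asboolP/eqP.
  move=> [j' [m' [h1 h2]]]; rewrite kE => /kappa_inj-/(_ jm)[|-> ->] //.
  by rewrite /type_pair; move: h1 h2; lia.
move=> ->; exists j, m; split => //; move: jm; rewrite /type_pair; move: m1 => /eqP; lia.
Qed.

Hypothesis tree_sum_fin : forall i tau, tree_sum i tau [::] \is a fin_num.

Lemma tree_sum_ge0 i tau vs : (0 <= tree_sum i tau vs)%E.
Proof. by apply: esum_ge0 => t _; rewrite lee_fin tweight_ge0. Qed.

Lemma ladder_massE i tau : (ladder_mass i tau)%:E = tree_sum i tau [::].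
Proof. by rewrite fineK. Qed.

Lemma ladder_mass_ge0 i tau : 0 <= ladder_mass i tau.
Proof. by rewrite -lee_fin ladder_massE tree_sum_ge0. Qed.

Lemma down_weight_ge0 i tau : 0 <= down_weight i tau.
Proof. by rewrite mulr_ge0 ?env_ge0 ?ladder_mass_ge0. Qed.

Lemma loop_weight_ge0 i l : 0 <= loop_weight i l.
Proof. by rewrite /loop_weight; case: ifP => // _; exact: down_weight_ge0. Qed.

Lemma exit_weight_ge0 i tau : 0 <= exit_weight i tau.
Proof. by rewrite /exit_weight; case: ifP => _; [exact: env_ge0|exact: down_weight_ge0]. Qed.

Hypothesis loop_weight_lt1 : forall i, \sum_l loop_weight i l < 1.

Lemma offspring_law_ge0 i k v : 0 <= offspring_law i k v.
Proof.
by rewrite mulr_ge0 ?subr_ge0 ?(ltW (loop_weight_lt1 _)) // mweight_above_ge0 // => l;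
  exact: loop_weight_ge0.
Qed.

Lemma type_pair0 (l : 'I_(ntypes R)) : (l < R)%N -> type_pair R 0 l.+1.
Proof. by rewrite /type_pair; lia. Qed.

Lemma kappa_ordP j m : type_pair R j m -> exists k : 'I_(ntypes R), k.+1 = kappa R j m.
Proof.
move=> /kappa_le /andP[h1 h2]; have h : ((kappa R j m).-1 < ntypes R)%N by rewrite prednK.
by exists (Ordinal h) => /=; rewrite prednK.
Qed.

Local Open Scope ereal_scope.

Let lin := lineage offspring_law.

(** The claim proved by induction on the length of [ws]. It is quantified over i because the
    excursions from i are trees started at i - 1. *)
Definition branching_at ws := forall i j m (k : 'I_(ntypes R)),
  type_pair R j m -> k.+1 = kappa R j m ->
  tree_sum i (j, m) ws = (ladder_mass i (j, m) * lin i (evec_ord k) ws)%:E.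

Let tcntsS n t : tcnts n.+1 t = tcnt t 0 :: mkseq (fun g => tcnt t g.+1) n.
Proof.
rewrite /tcnts /mkseq /= (iotaDl 1 0) -map_comp //.
Qed.

(** Trees without a loop at i. For m = 1 the tree is a single jump, all counts are zero, and so is
    the line of descent of the empty population. For m >= 2 it is [Over] applied to a tree of type
    (j + 1, m - 1), to which the hypothesis applies. *)
Lemma tree_sum_exit i j m v ws : branching_at ws -> type_pair R j m ->
  \esum_(t in [set t | (typed (j, m) t /\ tcnts (size ws).+1 t = v :: ws) /\
                       ~ exists t1 t2, t = Cat t1 t2]) (tweight w i t)%:E =
  (exit_weight i (j, m) * (v == exit_vec (j, m))%:R * lin (i - 1)%R v ws)%:E.
Proof.
move=> IH jm; rewrite /exit_weight /exit_vec /=; case: eqP => m1.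
  have jR : (j < R)%N by case/andP: jm.
  set S := [set t | _]; have SE t : S t ->
      [/\ t = Up (Ordinal jR), v = 0%R & all (pred1 0%R) ws].
    rewrite /S /=; case: t => [z|t|t1 t2] [[[wt tt]]] //=.
    - rewrite tcntsS => -[<- e] _; split => //.
        by move: tt => [zj _]; congr Up; apply/val_inj.
      by apply/all_pred1P; rewrite -[LHS]e mkseq_cst.
    - case/andP: wt => /wf_type_pair + _; move: tt => /= [_].
      by rewrite /type_pair => e /andP[_ /andP[m0 _]]; move: e m0; rewrite m1; lia.
    - by move=> _ []; exists t1, t2.
  case: eqP => [v0|v0]; last by rewrite mulr0 mul0r esum1 // => t /SE[].
  rewrite mulr1 v0 /lin lineage0; case: (boolP (all _ _)) => [ws0|ws0]; last first.
    by rewrite mulr0 esum1 // => t /SE[_ _]; rewrite (negbTE ws0).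
  rewrite (_ : S = [set Up (Ordinal jR)]).
    by rewrite esum_set1 ?mulr1 // lee_fin env_ge0.
  apply/seteqP; split => [t /SE[]//|_ ->]; rewrite /S /= /typed /= m1.
  split; last by move=> [? []].
  by split => //; rewrite tcntsS v0 /= mkseq_cst; congr cons; apply/esym/all_pred1P.
have jm' : type_pair R j.+1 m.-1.
  by move: jm m1; rewrite /type_pair => ? /eqP; lia.
have [k' k'E] := kappa_ordP jm'.
have kE t : ttype t = (j.+1, m.-1) -> evec R (tkappa t) = evec_ord k'.
  by move=> tt; rewrite /tkappa tt /= -k'E evec_ordE.
rewrite -k'E evec_ordE.
set S := [set t | _]; have SE t : S t <->
    v = evec_ord k' /\ (@Over R @` [set t | typed (j.+1, m.-1) t /\ tcnts (size ws) t = ws]) t.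
  rewrite /S /=; split.
    case: t => [z|t|t1 t2] [[[/= wt tt]]] //=.
    - by move: tt => [_] /esym.
    - case/andP: wt => wt t0; have {}tt : ttype t = (j.+1, m.-1).
        by move: tt t0; case: (ttype t) => a b /= [<- <-] a0; rewrite prednK.
      by rewrite tcntsS /= => -[<- e] _; rewrite kE //; split => //; exists t.
    - by move=> _ []; exists t1, t2.
  move=> [-> [t' [[wt tt] e] <-]]; split; last by move=> [? []].
  split; first by split => /=; rewrite ?wt tt //= prednK //; case/andP: jm; lia.
  by rewrite tcntsS /= kE //; congr cons.
case: eqP => [v0|v0]; last by rewrite mulr0 mul0r esum1 // => t /SE[].
rewrite mulr1 (_ : S = @Over R @` [set t | typed (j.+1, m.-1) t /\ tcnts (size ws) t = ws]);
  last first.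
  by apply/seteqP; split => t; [move=> /SE[]|move=> ?; apply/SE].
rewrite esum_image; last by move=> ? ? _ _ [].
rewrite /down_weight -mulrA EFinM v0 -(IH _ _ _ _ jm' k'E) /tree_sum -ge0_esumZl.
- by apply: eq_esum => t _; rewrite EFinM.
- by rewrite lee_fin env_ge0.
- by move=> t _; rewrite lee_fin tweight_ge0.
Qed.

Lemma tree_sum_cat i j m v ws : branching_at ws -> type_pair R j m ->
  \esum_(t in [set t | (typed (j, m) t /\ tcnts (size ws).+1 t = v :: ws) /\
                       exists t1 t2, t = Cat t1 t2]) (tweight w i t)%:E =
  \sum_(l | (0 < v ord0 l)%N && (l < R)%N) (q w i)%:E *
    \esum_(ab in splits ws) (tree_sum (i - 1)%R (0%N, l.+1) ab.1 *
                             tree_sum i (j, m) (vsub v (evec_ord l) :: ab.2)).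
Proof.
move=> IH jm; set n := size ws.
pose A1 : set (tree R) := [set t | wf t /\ (ttype t).1 = 0%N].
pose phi t := ((ttype t).2, tcnts n t).
(* The constraint on the loop type, the counts of the loop and those of the rest. The counts of the
   loop start one level lower, so they are added to those of the rest without its head. *)
pose C : set ((nat * seq (tvec R)) * seq (tvec R)) :=
  [set ab | [/\ (0 < ab.1.1 <= R)%N, size ab.1.2 = n, size ab.2 = n.+1 &
     (evec R ab.1.1 + head 0%R ab.2)%R = v /\ zip_add ab.1.2 (behead ab.2) = ws]].
set S := [set t | _].
have SE : S = (fun tt => Cat tt.1 tt.2) @` [set tt | [/\ A1 tt.1, typed (j, m) tt.2 &
    C (phi tt.1, tcnts n.+1 tt.2)]].
  have zipE t1 t2 : zip_add (tcnts n t1) (behead (tcnts n.+1 t2)) =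
      mkseq (fun g => tcnt t1 g + tcnt t2 g.+1)%R n.
    rewrite tcntsS /= /zip_add /tcnts; apply: (@eq_from_nth _ 0%R).
      by rewrite size_map size_zip !size_mkseq minnn.
    move=> g; rewrite size_map size_zip !size_mkseq minnn => gn.
    rewrite (nth_map (0%R, 0%R)) ?size_zip ?size_mkseq ?minnn //.
    by rewrite nth_zip ?size_mkseq //= !nth_mkseq.
  apply/seteqP; split => [t [[[wt tt] e] [t1 [t2 tE]]]|
                          _ [[t1 t2] /= [[w1 t10] [w2 tt2] [_ _ _ [e1 e2]]] <-]].
    move: wt tt e; rewrite {}tE => /= /and3P[w1 /eqP t10 w2] tt2.
    rewrite tcntsS /= => -[e1 e2]; exists (t1, t2) => //; split => //.
    split; rewrite /= ?size_map ?size_iota ?size_mkseq //.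
    - by have := wf_type_pair w1; rewrite /type_pair t10; lia.
    - by split; [rewrite -e1 /tkappa t10 kappa0|rewrite -e2; exact: zipE].
  split; last by exists t1, t2.
  split; first by split => //=; rewrite w1 t10 w2.
  rewrite tcntsS /=; congr cons; last by rewrite -zipE.
  by rewrite -e1 tcntsS /= /tkappa t10 kappa0.
rewrite SE esum_image; last by move=> [? ?] [? ?] _ _ [-> ->].
transitivity ((q w i)%:E * \esum_(tt in [set tt | [/\ A1 tt.1, typed (j, m) tt.2 &
    C (phi tt.1, tcnts n.+1 tt.2)]]) ((tweight w (i - 1)%R tt.1)%:E * (tweight w i tt.2)%:E)).
  rewrite -ge0_esumZl ?lee_fin ?env_ge0 //; last first.
    by move=> tt _; rewrite mule_ge0 ?lee_fin ?tweight_ge0.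
  by apply: eq_esum => tt _ /=; rewrite !EFinM muleA.
have tw0 i' t : 0 <= (tweight w i' t)%:E by rewrite lee_fin tweight_ge0.
rewrite (@esum_conv _ _ _ _ _ A1 (typed (j, m)) phi (tcnts n.+1) C
  (fun t => (tweight w (i - 1)%R t)%:E) (fun t => (tweight w i t)%:E)) //.
pose P l := (0 < v ord0 l)%N && (l < R)%N.
transitivity ((q w i)%:E * \esum_(l in [set l : 'I_(ntypes R) | P l])
    \esum_(ab in splits ws) (tree_sum (i - 1)%R (0%N, l.+1) ab.1 *
                             tree_sum i (j, m) (vsub v (evec_ord l) :: ab.2))); last first.
  rewrite esum_fintype; last first.
    by move=> l; apply: esum_ge0 => ab _; rewrite mule_ge0 ?tree_sum_ge0.
  rewrite ge0_sume_distrr // => l _; apply: esum_ge0 => ab _.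
  by rewrite mule_ge0 ?tree_sum_ge0.
congr (_ * _); rewrite esum_esum; last by move=> *; rewrite mule_ge0 ?tree_sum_ge0.
have bij : set_bij ([set l : 'I_(ntypes R) | P l] `*`` (fun=> splits ws)) C
   (fun x => ((x.1.+1, x.2.1), vsub v (evec_ord x.1) :: x.2.2)).
  split.
  - move=> [l [a b]] /= [/andP[vl lR] [/= sab e]].
    have sn : size a = n by rewrite /n -e /zip_add size_map size_zip sab minnn.
    split => //=; [by rewrite -sab sn|split => //].
    by rewrite evec_ordE vsubK // vle_evec.
  - move=> [l [a b]] [l' [a' b']] _ _ /= [ll' -> _ ->]; congr (_, _).
    exact/val_inj.
  - move=> [[m' a] [|b0 b]] [/= m'R sa // [sb] [e1 e2]].
    have lR : (m'.-1 < R)%N by lia.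
    pose l : 'I_(ntypes R) := Ordinal (leq_trans lR (leq_ntypes R)).
    have m'E : m' = l.+1 by rewrite /= prednK //; case/andP: m'R.
    rewrite m'E evec_ordE in e1.
    exists (l, (a, b)); last by rewrite /= -e1 vaddK -m'E.
    split; last by split => //=; rewrite sa sb.
    by rewrite /= /P lR -e1 vaddE mxE eqxx.
rewrite (reindex_esum _ _ _ _ bij); apply: eq_esum => -[l [a b]] /= [/andP[vl lR] [/= sab e]].
have sn : size a = n by rewrite /n -e /zip_add size_map size_zip sab minnn.
rewrite /tree_sum sn /= -sab sn; congr (_ * _); congr (esum _ _).
apply/seteqP; split => t /=.
  by move=> [[wt t0] [tl e']]; split => //; split => //; move: t0 tl;
    case: (ttype t) => ? ? /= -> ->.
by move=> [[wt tt] e']; rewrite /A1 /phi /= tt e'.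
Qed.

(* The right-hand side obeys the same recursion on the first loop; the induction
   is on the number of down-steps from level i. *)
Lemma tree_sum_cons i j m v ws :
  (forall ws', size ws' = size ws -> branching_at ws') -> type_pair R j m ->
  tree_sum i (j, m) (v :: ws) =
  (exit_weight i (j, m) * mweight_above (loop_weight i) (exit_vec (j, m)) v *
   lin (i - 1)%R v ws)%:E.
Proof.
move=> IH jm; have [N] := ubnP (vsize v); elim: N v ws IH => // N IHN v ws IH vN.
have lin_ge0 i' u us : (0 <= lin i' u us)%R by apply: lineage_ge0; exact: offspring_law_ge0.
rewrite /tree_sum /=.
rewrite (esumID [set t | exists t1 t2, t = Cat t1 t2]); last first.
  by move=> t _; rewrite lee_fin tweight_ge0.
rewrite tree_sum_cat ?tree_sum_exit //; try by apply: IH.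
(* The loop falls under [IH], its counts having the length of [ws]; the rest has one loop fewer and
   falls under [IHN]. [lineage_splits] then joins the descendants of e_l and of v - e_l into those
   of v. *)
rewrite (eq_bigr (fun l => (loop_weight i l * (exit_weight i (j, m) *
   mweight_above (loop_weight i) (exit_vec (j, m)) (vsub v (evec_ord l)) *
   lin (i - 1)%R v ws))%:E)); last first.
  move=> l /andP[vl lR]; have vK : (evec_ord l + vsub v (evec_ord l))%R = v by rewrite vsubK ?vle_evec.
  have vN' : (vsize (vsub v (evec_ord l)) < N)%N.
    by move: vN; rewrite -{1}vK vsizeD vsize_evec.
  have -> : lin (i - 1)%R v ws = lin (i - 1)%R (evec_ord l + vsub v (evec_ord l))%R ws by rewrite vK.
  move: (vsub v (evec_ord l)) vN' => v' vN'; rewrite /loop_weight lR /down_weight.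
  transitivity ((q w i)%:E * \esum_(ab in splits ws)
     ((ladder_mass (i - 1)%R (0%N, l.+1) * (exit_weight i (j, m) *
        mweight_above (loop_weight i) (exit_vec (j, m)) v'))%:E *
      ((lin (i - 1)%R (evec_ord l) ab.1)%:E * (lin (i - 1)%R v' ab.2)%:E))).
    congr (_ * _); apply: eq_esum => -[a b] [/= sab e].
    have sa : size a = size ws by rewrite -e /zip_add size_map size_zip sab minnn.
    rewrite (IH a sa _ _ _ l) ?kappa0 ?type_pair0 // IHN //; last first.
      by move=> ws' sws'; apply: IH; rewrite sws' -sab.
    by rewrite -!EFinM; congr _%:E; ring.
  rewrite ge0_esumZl; last 2 first.
  - by rewrite lee_fin !mulr_ge0 ?ladder_mass_ge0 ?exit_weight_ge0 ?mweight_above_ge0 // => l'; exact: loop_weight_ge0.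
  - by move=> ab _; rewrite mule_ge0 ?lee_fin.
  rewrite lineage_splits; last exact: offspring_law_ge0.
  by rewrite -!EFinM; congr _%:E; rewrite /lin; ring.
rewrite sumEFin -EFinD mweight_above_rec [in RHS]mulrDr [in RHS]mulrDl addrC.
congr (_ + _)%R%:E.
rewrite [in RHS]big_distrr [in RHS]big_distrl /= big_mkcond; apply: eq_bigr => l _.
case: ifPn => [/andP[-> lR]|]; first by ring.
rewrite negb_and; case: (0 < v ord0 l)%N => /=; last by rewrite mulr0 mul0r.
by rewrite /loop_weight => /negbTE ->; rewrite mul0r mulr0 mul0r.
Qed.

Let loop_ge0 i := @loop_weight_ge0 i.

Lemma branching_at_nil : branching_at [::].
Proof. by move=> i j m k _ _; rewrite mulr1 ladder_massE. Qed.

(** Summing [tree_sum_cons] with empty tail over v, the free loops contribute the geometric factor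
    of [esum_mweight]. *)
Lemma ladder_mass_exit i j m : type_pair R j m ->
  (ladder_mass i (j, m) = exit_weight i (j, m) / (1 - \sum_l loop_weight i l))%R.
Proof.
move=> jm; apply: EFin_inj; rewrite ladder_massE /tree_sum.
rewrite (esum_fibre (B := setT) (phi := fun t => tcnt t 0)) //; last first.
  by move=> t _; rewrite lee_fin tweight_ge0.
transitivity (\esum_(v in [set: tvec R]) ((exit_weight i (j, m))%:E *
    (1 * mweight_above (loop_weight i) (exit_vec (j, m)) v)%:E)).
  apply: eq_esum => v _; rewrite -EFinM mul1r.
  have := @tree_sum_cons i j m v [::] _ jm; rewrite /= mulr1 => <-; last first.
    by move=> [|//] _; exact: branching_at_nil.
  congr (esum _ _); apply/seteqP; split => t /=.
    by move=> [[tt _] e]; split => //; rewrite /tcnts /mkseq /= e.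
  by move=> [tt]; rewrite /tcnts /mkseq /= => -[e].
rewrite ge0_esumZl ?lee_fin ?exit_weight_ge0 //; last first.
  by move=> v _; rewrite lee_fin mul1r mweight_above_ge0.
rewrite (esum_mweight_above (loop_ge0 i) _ (fun _ => ler01)).
under eq_esum do rewrite mul1r.
by rewrite esum_mweight // -EFinM mulrA mulr1.
Qed.

Lemma branching_at_all ws : branching_at ws.
Proof.
have [N] := ubnP (size ws); elim: N ws => // N IHN [|v ws] sN.
  exact: branching_at_nil.
move=> i j m k jm kE; rewrite tree_sum_cons //; last first.
  by move=> ws' sws'; apply: IHN; rewrite sws'.
(* The denominator of [ladder_mass] cancels the stopping factor of [offspring_law]. *)
rewrite /lin /= offspring_sum1 /offspring_law (exit_vec_ordE jm kE) ladder_mass_exit //.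
have s1 : (1 - \sum_l loop_weight i l != 0)%R by rewrite subr_eq0 gt_eqF.
by congr _%:E; field.
Qed.

Lemma tree_sum_exits i j m v : type_pair R j m ->
  tree_sum i (j, m) [:: v] =
  (exit_weight i (j, m) * mweight_above (loop_weight i) (exit_vec (j, m)) v)%:E.
Proof.
move=> jm; rewrite tree_sum_cons ?mulr1 // => ws _; exact: branching_at_all.
Qed.

Lemma offspring_law_pmf i k : is_pmf (offspring_law i k).
Proof.
split=> [v|]; first exact: offspring_law_ge0.
transitivity (\esum_(v in [set: tvec R]) ((1 - \sum_l loop_weight i l)%:E *
    (1 * mweight_above (loop_weight i) (exit_vec_ord k) v)%:E)).
  by apply: eq_esum => v _; rewrite -EFinM mul1r.
rewrite ge0_esumZl ?lee_fin ?subr_ge0 ?(ltW (loop_weight_lt1 _)) //; last first.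
  by move=> v _; rewrite lee_fin mul1r mweight_above_ge0.
rewrite (esum_mweight_above (loop_ge0 i) _ (fun _ => ler01)).
under eq_esum do rewrite mul1r.
rewrite esum_mweight // -EFinM mulrA mulr1 divff //.
by rewrite subr_eq0 gt_eqF.
Qed.

Lemma offspring_law_mean i k l :
  \esum_(v in [set: tvec R]) ((v ord0 l)%:R * offspring_law i k v)%:E =
  ((exit_vec_ord k ord0 l)%:R + loop_weight i l / (1 - \sum_l loop_weight i l))%:E.
Proof.
have s1 : (1 - \sum_l loop_weight i l != 0)%R by rewrite subr_eq0 gt_eqF.
transitivity (\esum_(v in [set: tvec R]) ((1 - \sum_l loop_weight i l)%:E *
    ((v ord0 l)%:R * mweight_above (loop_weight i) (exit_vec_ord k) v)%:E)).
  by apply: eq_esum => v _; rewrite -EFinM mulrCA.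
rewrite ge0_esumZl ?lee_fin ?subr_ge0 ?(ltW (loop_weight_lt1 _)) //; last first.
  by move=> v _; rewrite lee_fin mulr_ge0 ?mweight_above_ge0.
rewrite (esum_mweight_above (loop_ge0 i) _ (fun v => ler0n _ (v ord0 l))).
transitivity ((1 - \sum_l loop_weight i l)%:E * \esum_(v in [set: tvec R])
   (((exit_vec_ord k ord0 l)%:R)%:E * (mweight (loop_weight i) v)%:E +
    ((v ord0 l)%:R * mweight (loop_weight i) v)%:E)).
  by congr (_ * _); apply: eq_esum => v _; rewrite vaddE natrD mulrDl EFinD EFinM.
rewrite esumD; last 2 first.
- by move=> v _; rewrite mule_ge0 ?lee_fin ?mweight_ge0.
- by move=> v _; rewrite lee_fin mulr_ge0 ?mweight_ge0.
rewrite ge0_esumZl ?lee_fin ?ler0n //; last by move=> v _; rewrite lee_fin mweight_ge0.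
rewrite esum_mweight // esum_mweight_mean // -!EFinM; congr _%:E.
by field.
Qed.

End TreeSums.

(** * The walk in a fixed environment *)

Lemma esum_subset (K : realType) (T : choiceType) (A B : set T) (f : T -> \bar K) :
  A `<=` B -> (\esum_(t in A) f t <= \esum_(t in B) f t)%E.
Proof.
move=> AB; apply: ge_ereal_sup => _ [X [finX XA] <-].
by apply: esum_ge; exists X => //; split => //; exact: subset_trans AB.
Qed.

Lemma evec_inj R a b : (0 < a <= ntypes R)%N -> evec R a = evec R b -> a = b.
Proof.
move=> aR /rowP ab; have h : (a.-1 < ntypes R)%N by lia.
have := ab (Ordinal h); rewrite !mxE /= prednK; last by lia.
by rewrite eqxx; case: eqP.
Qed.

Lemma vsize_evecn R a : (0 < a <= ntypes R)%N -> vsize (evec R a) = 1%N.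
Proof.
move=> aR; have h : (a.-1 < ntypes R)%N by lia.
have -> : a = (Ordinal h).+1 by rewrite /= prednK //; lia.
by rewrite evec_ordE vsize_evec.
Qed.

Section Quenched.
Variables (K : realType) (R : nat) (w : env K R).
Variable Q : int -> env K R -> {measure set traj -> \bar K}.
Hypothesis Q1 : forall i, Q i w setT = 1%E.
Hypothesis Qlaw : forall i, walk_law w i (Q i w).
Hypothesis q_lt1 : forall i, q w i < 1.
Hypothesis escape : (Q 0 w).-negligible [set x : traj | ~ exists n, 0 < x n].
Implicit Types (i : int) (j m : nat).

(** The weights are the probabilities of disjoint events for the walk started at i. *)
Lemma tree_event i (T : set (tree R)) : (forall t, T t -> wf t) ->
  (\esum_(t in T) (tweight w i t)%:E <= 1)%E.
Proof.
move=> Twf; pose s : nat -> int := fun=> i.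
pose E := [set x : traj | exists t, T t /\ (cyl 0 s x /\ follows x 0 t)].
have mE : measurable E.
  apply: meas_ex => t; have [Tt|Tt] := pselect (T t).
    apply: meas_and; first exact: meas_cst.
    by case: (mu_tree (Qlaw i) 0 s (Twf _ Tt)).
  rewrite (_ : [set x | _] = set0) //.
  by apply/seteqP; split => // x [].
have c0 : Q i w (cyl 0 s) = 1%E.
  rewrite -(proj1 (Qlaw i)); congr (Q i w _); apply/seteqP; split => x /=; first exact.
  by move=> x0 [|].
have := tree_law (Qlaw i) (n := 0) (s := s) Twf mE (negligible_set0 _).
rewrite c0 mul1e => <-; last first.
  by move=> x _; split => [[t [? []]]|[t []]]; exists t.
by rewrite -(Q1 i) le_measure ?inE.
Qed.

Lemma tree_sum_finite i tau : tree_sum w i tau [::] \is a fin_num.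
Proof.
rewrite ge0_fin_numE ?tree_sum_ge0 //; apply: le_lt_trans (ltry 1).
by apply: tree_event => t [[]].
Qed.

(** Every loop begins with a step down, and the trees from i - 1 that end at i have total weight at
    most 1; the sum is thus at most q(i). *)
Lemma loop_sum_lt1 i : \sum_l loop_weight w i l < 1.
Proof.
apply: le_lt_trans (q_lt1 i).
pose T : set (tree R) := [set t | wf t /\ (ttype t).1 = 0%N].
have Twf t : T t -> wf t by case.
have le1 := tree_event (i - 1) Twf.
have tw0 t : (0 <= (tweight w (i - 1) t)%:E)%E by rewrite lee_fin tweight_ge0.
rewrite (esum_fibre (B := setT) (phi := fun t => (ttype t).2)) // in le1.
have : (\sum_(l < ntypes R | (l < R)%N) (ladder_mass w (i - 1) (0%N, l.+1))%:E <= 1)%E.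
  apply: le_trans le1; rewrite -esum_fintype; last first.
    by move=> l; rewrite ladder_massE ?tree_sum_ge0 //; exact: tree_sum_finite.
  pose g n := (\esum_(s in [set s | T s /\ (ttype s).2 = n]) (tweight w (i - 1) s)%:E)%E.
  pose S := (fun l : 'I_(ntypes R) => l.+1) @` [set l : 'I_(ntypes R) | (l < R)%N].
  apply: (@le_trans _ _ (\esum_(n in S) g n)%E); last exact: esum_subset.
  rewrite esum_image; last by move=> a b _ _ [ab]; exact/val_inj.
  apply: le_esum => l _; rewrite ladder_massE; last exact: tree_sum_finite.
  by apply: esum_subset => t [[wt tt] _]; rewrite /= /T /= tt.
rewrite sumEFin lee_fin => le1'.
rewrite /loop_weight -big_mkcond /= /down_weight -big_distrr /=.
by rewrite ler_piMr // env_ge0.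
Qed.

Lemma cyl0E i : Q i w (cyl 0 (fun=> i)) = 1%E.
Proof.
rewrite -(proj1 (Qlaw i)); congr (Q i w _); apply/seteqP; split => x /=; first exact.
by move=> x0 [|].
Qed.

(** The first step is placed in a cylinder of length one. What follows is a tree from i - 1, whose
    type is (j, m) exactly when its last jump goes from i - m to i + j. *)
Lemma pcrossE i j m : type_pair R j m ->
  pcross Q w (kappa R j m) i = down_weight w i (j, m).
Proof.
move=> jm; pose s r : int := if r == 1%N then i - 1 else i.
have N1 := negligibleU (start_negligible (Q1 i) (Qlaw i)) (inadmissible_negligible (Qlaw i)).
rewrite /pcross (tree_law (Qlaw i) (n := 1) (s := s) (T := @typed R (j, m)) _ _ N1).
- rewrite (mu_cylS (Qlaw i) 0 (fun=> i) (i - 1)) cyl0E mul1e transition_down /= fineM //.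
    rewrite /down_weight /ladder_mass /tree_sum; congr (_ * fine (esum _ _)).
    by apply/seteqP; split => t //= [].
  have := tree_sum_finite (i - 1) (j, m); rewrite /tree_sum.
  by congr (_ \is a fin_num); congr (esum _ _); apply/seteqP; split => t //= [].
- by move=> t [].
- exact: meas_down_step.
move=> x /not_orP[/contrapT x0 /contrapT xadm]; split; last first.
  move=> [t [[wt tt] c f]]; have x0i : x 0%N = i by exact: c.
  have x1 : x 1%N = x 0%N - 1 by rewrite x0i; exact: (c 1%N).
  by have := (down_step_tree (kappa R j m) wt x1 f).2; rewrite x0i /tkappa tt; apply.
move=> [_ x1 [j' [m' [jm' kk [n [n0 lt_x e1 e2]]]]]].
have [jj mm] := kappa_inj jm jm' kk; rewrite -jj -mm x0 in e1 e2.
have [||t [wt ft tn]] := ladder_follows xadm (n0 : (1 < n.+1)%N).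
- by move=> r rn; have := lt_x r; rewrite x0 x1; lia.
- by rewrite e2 x1; lia.
exists t; split => //; last first.
  by move=> [|[|]].
have [_ e1' e2'] := follows_spec wt ft; split => //.
rewrite tn e2 x1 in e1'; move: e2'; have -> : (1 + (tlen t).-1 = n)%N by have := tlen_gt0 t; lia.
rewrite e1 x1; case: (ttype t) e1' => a b /= e1' e2'; congr (_, _); lia.
Qed.

Lemma pstopE i : pstop Q w i = 1 - \sum_l loop_weight w i l.
Proof.
rewrite /pstop big_add1 /= big_mkord; congr (1 - _).
rewrite (eq_bigr (fun k : 'I_R => down_weight w i (0%N, k.+1))); last first.
  by move=> k _; rewrite -pcrossE ?kappa0 // /type_pair; have := ltn_ord k; lia.
rewrite (big_ord_widen _ (fun k => down_weight w i (0%N, k.+1)) (leq_ntypes R)).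
by rewrite big_mkcond.
Qed.

Lemma exit_weight_pcross i j m : (j + 2 <= R)%N -> (2 <= m <= R - j)%N ->
  exit_weight w i (j, m) = pcross Q w (kappa R j.+1 m.-1) i.
Proof.
move=> jR mR; rewrite pcrossE; last by rewrite /type_pair; lia.
by rewrite /exit_weight /= ifF //; lia.
Qed.

Lemma good_negligible :
  (Q 0 w).-negligible [set x | ~ (x 0%N = 0 /\ exists t, wf t /\ @follows R x 0 t)].
Proof.
have N1 := negligibleU (start_negligible (Q1 0) (Qlaw 0)) (inadmissible_negligible (Qlaw 0)).
apply: negligibleS (negligibleU N1 escape) => x /= bad.
have [x0|x0] := pselect (x 0%N = 0); last by left; left.
have [xadm|xadm] := pselect (admissible R x); last by left; right.
right => xn; apply: bad; split => //.
(* Since the path starts at 0, this [b] is the time T_1. *)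
case: (ex_minnP xn) => b xb bmin.
have b0 : (0 < b)%N by case: b xb {bmin} => //; rewrite x0 ltxx.
have [||t [wt ft _]] := ladder_follows xadm b0; last by exists t.
- move=> r rb; rewrite x0 leNgt; apply/negP => xr.
  by have := bmin r xr; lia.
- by rewrite x0.
Qed.

(** * The joint law of the generations of U *)

Definition generations (vs : seq (tvec R)) (x : traj) :=
  forall g, (g < size vs)%N -> U R (- g%:Z) x = nth 0 vs g.

Lemma meas_generations v vs :
  measurable [set x : traj | U R 1 x = v /\ generations vs x].
Proof.
apply: meas_and; first exact: meas_U.
by apply: meas_all => g; apply: meas_imp; [exact: meas_cst|exact: meas_U].
Qed.

(** Almost surely the path up to T_1 is a unique tree from level 0. Its type is recorded by U(1), as
    its last jump goes from 1 - m to 1 + j, and its counts are the U(-g). *)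
Lemma generations_law j m vs : type_pair R j m ->
  Q 0 w [set x | U R 1 x = evec R (kappa R j m) /\ generations vs x] =
  tree_sum w 0 (j, m) vs.
Proof.
move=> jm.
rewrite (tree_law (Qlaw 0) (n := 0) (s := fun=> 0)
  (T := [set t | @typed R (j, m) t /\ tcnts (size vs) t = vs]) _ _ good_negligible).
- by rewrite cyl0E mul1e.
- by move=> t [[]].
- exact: meas_generations.
move=> x /contrapT[x0 [t [wt ft]]].
have gen t' : wf t' -> follows x 0 t' -> generations vs x <-> tcnts (size vs) t' = vs.
  move=> wt' ft'; rewrite /generations; split => [h|h g gs].
    apply: (@eq_from_nth _ 0); rewrite size_mkseq // => g gs.
    by rewrite nth_mkseq // -h // (U_tree _ wt' ft' x0).
  by rewrite (U_tree _ wt' ft' x0) -{1}h nth_mkseq.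
split=> [[u1 gx]|[t' [[[wt' tt] e] _ ft']]].
  exists t; split; [split; [split|exact/(gen t)]|by move=> [|]|] => //.
  move: u1; rewrite (U1_tree wt ft x0) => /evec_inj; rewrite kappa_le ?wf_type_pair // => /(_ isT).
  by move=> /kappa_inj-/(_ (wf_type_pair wt) jm)[<- <-]; rewrite -surjective_pairing.
split; last exact/(gen t').
by rewrite (U1_tree wt' ft' x0) /tkappa tt.
Qed.

Lemma history_law n (u : nat -> tvec R) (k : 'I_(ntypes R)) j m :
  type_pair R j m -> k.+1 = kappa R j m -> u 0%N = evec_ord k ->
  Q 0 w (history (@U R) n u) =
  (ladder_mass w 0 (j, m) *
   lineage (offspring_law w) 0 (u 0%N) (mkseq (fun g => u g.+1) n))%:E.
Proof.
move=> jm kE uk.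
rewrite uk -(branching_at_all tree_sum_finite loop_sum_lt1) // -generations_law //.
congr (Q 0 w _); rewrite -kE evec_ordE -uk /history /generations size_mkseq.
apply/seteqP; split => x /= h.
  split; first by rewrite -(h 0%N) ?subr0.
  move=> g gn; rewrite nth_mkseq // -h //; congr U; lia.
case: h => h0 h [|g] gn; first by rewrite subr0.
rewrite (_ : 1 - g.+1%:Z = - g%:Z); last by lia.
by rewrite h // nth_mkseq.
Qed.

(** U(1) is almost surely a unit vector, so for other initial values both sides of the Markov
    property vanish. *)
Lemma history_null n (u : nat -> tvec R) :
  (forall j m, type_pair R j m -> u 0%N <> evec R (kappa R j m)) ->
  Q 0 w (history (@U R) n u) = 0%E.
Proof.
move=> nu; apply: measure_negligible.
  by apply: meas_all => g; apply: meas_imp; [exact: meas_cst|exact: meas_U].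
apply: negligibleS good_negligible => x /= h [x0 [t [wt ft]]].
apply: (nu _ _ (wf_type_pair wt)).
by rewrite -(h 0%N) // subr0 (U1_tree wt ft x0).
Qed.

Lemma walk_branching : branching_process (Q 0 w) (@U R) (offspring_law w).
Proof.
split=> [i k _|n u]; first exact: offspring_law_pmf tree_sum_finite loop_sum_lt1 _ _.
have [[j [m [jm u0]]]|nu] := pselect (exists j m, type_pair R j m /\ u 0%N = evec R (kappa R j m)).
  have [k kE] := kappa_ordP jm; rewrite -kE evec_ordE in u0.
  rewrite (history_law _ jm kE u0) (history_law _ jm kE u0) mkseqS lineage_rcons.
  rewrite size_mkseq add0r -EFinM mulrA.
  by case: n => // n; rewrite mkseqS last_rcons.
rewrite !history_null ?mul0e // => j m jm u0; apply: nu; by exists j, m.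
Qed.

Lemma walk_mean i k l :
  (\esum_(v in [set: tvec R]) ((v ord0 l)%:R * offspring_law w i k v)%:E =
   (mean_matrix Q w i k l)%:E)%E.
Proof.
rewrite offspring_law_mean; [|exact: tree_sum_finite|exact: loop_sum_lt1].
rewrite mxE -pstopE /loop_weight mxE; case: ifPn => lR; last by rewrite mul0r addr0.
rewrite asboolF ?add0r; last first.
  move=> [j [m [jR mR _ lE]]].
  have : type_pair R j.+1 m.-1 by rewrite /type_pair; lia.
  by move=> /kappaS_gt; rewrite -lE; lia.
by rewrite -pcrossE ?kappa0 // type_pair0.
Qed.

Lemma immigration j m : type_pair R j m ->
  Q 0 w [set x | U R 1 x = evec R (kappa R j m)] =
  (exit_weight w 0 (j, m) / pstop Q w 0)%:E.
Proof.
move=> jm; rewrite pstopE -ladder_mass_exit //; [|exact: tree_sum_finite|exact: loop_sum_lt1].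
rewrite ladder_massE; last exact: tree_sum_finite.
rewrite -generations_law //; congr (Q 0 w _).
by apply/seteqP; split => x /=; [move=> ->|case].
Qed.

Lemma mweight_padvec i (u : R.-tuple nat) :
  mweight (loop_weight w i) (padvec u) = multinomial_weight Q w i u.
Proof.
rewrite /mweight /multinomial_weight; congr (_`!%:R / _%:R * _).
- rewrite /vsize (eq_bigr (fun l : 'I_(ntypes R) => nth 0%N u l)); last by move=> l _; rewrite mxE.
  rewrite (eq_bigr (fun k : 'I_R => nth 0%N u k)); last by move=> k _; rewrite (tnth_nth 0%N).
  rewrite (big_ord_widen _ (nth 0%N u) (leq_ntypes R)) [RHS]big_mkcond /=.
  by apply: eq_bigr => l _; case: ltnP => // Rl; rewrite nth_default // size_tuple.
- rewrite (eq_bigr (fun l : 'I_(ntypes R) => (nth 0%N u l)`!)); last by move=> l _; rewrite mxE.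
  rewrite (eq_bigr (fun k : 'I_R => (nth 0%N u k)`!)); last by move=> k _; rewrite (tnth_nth 0%N).
  rewrite (big_ord_widen _ (fun k => (nth 0%N u k)`!) (leq_ntypes R)) [RHS]big_mkcond /=.
  by apply: eq_bigr => l _; case: ltnP => // Rl; rewrite nth_default // size_tuple.
- rewrite (eq_bigr (fun k : 'I_R => down_weight w i (0%N, k.+1) ^+ nth 0%N u k)); last first.
    move=> k _; rewrite (tnth_nth 0%N) -pcrossE ?kappa0 // /type_pair.
    by have := ltn_ord k; lia.
  rewrite (big_ord_widen _ (fun k => down_weight w i (0%N, k.+1) ^+ nth 0%N u k) (leq_ntypes R)).
  rewrite [RHS]big_mkcond /=; apply: eq_bigr => l _; rewrite mxE /loop_weight; case: ltnP => // Rl.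
  by rewrite nth_default ?size_tuple.
Qed.

Lemma first_generation j m (u : R.-tuple nat) : type_pair R j m ->
  cond_prob (Q 0 w)
    [set x | U R 0 x = padvec u + @exit_vec R (j, m) /\ U R 1 x = evec R (kappa R j m)]
    [set x | vsize (U R 1 x) = 1%N] =
  multinomial_weight Q w 0 u * exit_weight w 0 (j, m).
Proof.
move=> jm; rewrite /cond_prob.
(* The conditioning event is almost sure, so the conditional probability is the plain one. *)
have -> : Q 0 w [set x | vsize (U R 1 x) = 1%N] = 1%E.
  rewrite -(Q1 0); apply: (eq_measure_mod _ measurableT good_negligible).
    apply: (meas_iff (F := fun x => exists v : tvec R, U R 1 x = v /\ vsize v = 1%N)).
      by move=> x; split => [h|[v [<-]]//]; exists (U R 1 x).
    by apply: meas_ex => v; apply: meas_and; [exact: meas_U|exact: meas_cst].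
  move=> x /contrapT[x0 [t [wt ft]]]; split => // _ /=.
  by rewrite (U1_tree wt ft x0) vsize_evecn // kappa_le // wf_type_pair.
rewrite divr1 -mweight_padvec mulrC.
pose v := padvec u + @exit_vec R (j, m).
have -> : mweight (loop_weight w 0) (padvec u) =
    mweight_above (loop_weight w 0) (@exit_vec R (j, m)) v.
  by rewrite /mweight_above /v addrC vle_add vaddK.
rewrite -[RHS]/(fine (_%:E)) -tree_sum_exits //; [|exact: tree_sum_finite|exact: loop_sum_lt1].
rewrite -generations_law //; congr (fine (Q 0 w _)); apply/seteqP; split => x /=.
  by move=> [[u0 u1] _]; split => // -[|].
move=> [u1 h]; split; last by rewrite u1 vsize_evecn // kappa_le.
by split => //; rewrite -[RHS](h 0%N).
Qed.

End Quenched.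

(** * Almost every environment *)

(** Natural thresholds suffice by the Archimedean property, which makes transience a countable
    combination of coordinate events. *)
Lemma cvg_int_pinfty (K : realType) (x : nat -> int) :
  ((x n)%:~R : K) @[n --> \oo] --> +oo <->
  forall M : nat, exists N : nat, forall n : nat, (N <= n)%N -> M%:Z <= x n.
Proof.
rewrite cvgryPge; split => [h M|h a].
  have [N _ hN] := h M%:R; exists N => n Nn.
  by have := hN n Nn; rewrite /= -[M%:R]/(M%:Z%:~R) ler_int.
have [N hN] := h (Num.bound `|a|); exists N => // n /= Nn.
apply: (@le_trans _ _ (Num.bound `|a|)%:R).
  by apply: le_trans (ler_norm a) _; apply: ltW; exact: archi_boundP.
by rewrite -[X in X <= _]/((Num.bound `|a|)%:Z%:~R) ler_int hN.
Qed.

Definition transient (K : realType) : set traj :=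
  [set x | ((x n)%:~R : K) @[n --> \oo] --> +oo].

Lemma measurable_transient (K : realType) : measurable (transient K).
Proof.
apply: (meas_iff (F := fun x => forall M : nat, exists N : nat,
  forall n : nat, (N <= n)%N -> M%:Z <= x n)); first by move=> x; exact: cvg_int_pinfty.
apply: meas_all => M; apply: meas_ex => N; apply: meas_all => n.
by apply: meas_imp; [exact: meas_cst|exact: (meas_pred (fun y => M%:Z <= y))].
Qed.

Lemma transient_escape (K : realType) (mu : {measure set traj -> \bar K}) :
  mu setT = 1%E -> mu (transient K) = 1%E ->
  mu.-negligible [set x : traj | ~ exists n, 0 < x n].
Proof.
move=> mu1 muC; have mC := @measurable_transient K.
apply: (@negligibleS _ _ _ _ (~` transient K)).
  move=> x /= nx /cvg_int_pinfty/(_ 1%N)[N hN]; apply: nx; exists N.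
  by apply: lt_le_trans (hN N _).
apply/negligibleP; first exact: measurableC.
by rewrite -setTD measureD //= ?setTI ?mu1 ?muC ?subee // ltry.
Qed.

(** The function 1 - f is nonnegative with zero integral, hence vanishes almost everywhere. *)
Lemma ae_integral1 d (T : measurableType d) (K : realType) (P : probability T K)
    (f : T -> \bar K) : @measurable_fun _ _ T (\bar K) setT f ->
  (forall w, 0 <= f w <= 1)%E -> (\int[P]_w f w = 1)%E ->
  {ae P, forall w, f w = 1%E}.
Proof.
move=> mf f01 If; pose g w := (1 - f w)%E.
have fin w : f w \is a fin_num.
  by have /andP[f0 f1] := f01 w; rewrite ge0_fin_numE // (le_lt_trans f1) ?ltry.
have g0 w : (0 <= g w)%E by rewrite sube_ge0 ?fin //; case/andP: (f01 w).
have mg : @measurable_fun _ _ T (\bar K) setT g by apply: emeasurable_funB => //;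
  exact: measurable_cst.
have Ig : (\int[P]_w g w = 0)%E.
  have : (\int[P]_w (f w + g w) = 1)%E.
    under eq_integral do rewrite /g addeC subeK ?fin //.
    by rewrite integral_cst // mul1e; exact: probability_setT.
  rewrite ge0_integralD //; last by move=> w _; case/andP: (f01 w).
  rewrite If; case: (\int[P]_w g w)%E => [r| |] //; rewrite -EFinD => -[e].
  by congr _%:E; lra.
have [+ _] := ae_eq_integral_abs P measurableT mg.
rewrite (eq_integral g); last by move=> w _; rewrite gee0_abs.
move=> /(_ Ig); apply: filterS => w /(_ I) /=; rewrite /g => /eqP.
by rewrite sube_eq ?fin // add0e => /eqP.
Qed.

Section AlmostEvery.
Variables (K : realType) (R : nat) (P : probability (env K R) K).

(** At site 0, q = 1 would force p_1 = 0 against ellipticity. Stationarity carries the null event to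
    every site, upwards and downwards, and there are countably many sites. *)
Lemma ae_q_lt1 : (0 < R)%N -> stationary P -> elliptic P ->
  {ae P, forall w : env K R, forall i : int, q w i < 1}.
Proof.
move=> R0 Pstat [eps eps0 Pell].
pose B i : set (env K R) := [set w | 1 <= q w i].
have mB i : measurable (B i).
  apply: sub_sigma_algebra; exists i, ord0, [set y | 1 <= y]; split => //.
  rewrite (_ : [set y | _] = `[1, +oo[%classic) //.
  by apply/seteqP; split => y /=; rewrite in_itv /= andbT.
have BS i : P (B (i + 1)) = P (B i) by rewrite -(Pstat _ (mB i)).
have B0 : P (B 0) = 0%E.
  apply: measure_negligible => //; apply: negligibleS Pell => w /= q1 h.
  have := h 1%N; rewrite R0 => /(_ isT).
  have /andP[/forallP w0 /eqP w1] := valP (w 0).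
  have p0 : p w 1 0 = 0.
    move: w1; rewrite (bigD1 ord0) //= => w1.
    have ne : (inord 1 : 'I_R.+1) != ord0 by rewrite -val_eqE /= inordK // ltnS.
    move: w1; rewrite (bigD1 (inord 1)) //= => w1.
    have s0 : 0 <= \sum_(i < R.+1 | (i != ord0) && (i != inord 1)) val (w 0) i by apply: sumr_ge0.
    have := w0 (inord 1); move: q1; rewrite /q /p /= in w1 s0 * => q1 p0.
    by apply/eqP; rewrite eq_le p0 andbT; move: w1 s0 q1 p0; rewrite /B /q /=; lra.
  rewrite p0 mul0e lee_fin leNgt eps0 //.
have Bn (n : nat) : P (B n%:Z) = 0%E.
  by elim: n => // n IH; rewrite -addn1 PoszD BS.
have BN (n : nat) : P (B (- n%:Z)) = 0%E.
  elim: n => // n IH; rewrite -BS -IH; congr (P (B _)); lia.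
have Bi i : P (B i) = 0%E by case: (intP i) => [|n|n]; [exact: B0|exact: Bn|exact: BN].
pose F n := if choice.unpickle n is Some i then B i else set0.
apply: (@negligibleS _ _ _ _ (\bigcup_n F n)).
  move=> w /= /existsNP[i /negP]; rewrite -leNgt => qi.
  by exists (choice.pickle i) => //; rewrite /F choice.pickleK.
apply: negligible_bigcup => n; rewrite /F; case: choice.unpickle => [i|];
  last exact: negligible_set0.
by apply/negligibleP; [exact: mB|exact: Bi].
Qed.

Lemma ae_transient (Q : int -> K.-pker (env K R) ~> traj) :
  annealed P (Q 0)
     [set wx | ((wx.2 n)%:~R : K) @[n --> \oo] --> +oo] = 1%E ->
  {ae P, forall w : env K R, Q 0 w (transient K) = 1%E}.
Proof.
move=> h; apply: ae_integral1.
- exact: (measurable_kernel (Q 0) _ (@measurable_transient K)).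
- move=> w; rewrite measure_ge0 /= -(prob_kernel (s := Q 0) w) le_measure ?inE //.
  exact: measurable_transient.
- rewrite -h /annealed; apply: eq_integral => w _; congr (Q 0 w _).
  by apply/seteqP; split => x; rewrite /xsection /= inE.
Qed.

End AlmostEvery.

Theorem theorem5p1 (K : realType) (R : nat) (hR : (1 <= R)%N)
  (P : probability (env K R) K)
  (Pstat : stationary P) (Perg : ergodic P) (Pell : elliptic P)
  (Q : int -> K.-pker (env K R) ~> traj)
  (hQ : forall (k : int) (w : env K R), walk_law w k (Q k w))
  (htrans : annealed P (Q 0)
     [set wx | ((wx.2 n)%:~R : K) @[n --> \oo] --> +oo] = 1%E) :
  {ae P, forall w : env K R,
    (exists off : int -> 'I_(ntypes R) -> tvec R -> K,
      branching_process (Q 0 w) (@U R) off /\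
      forall (i : int) (k l : 'I_(ntypes R)), i <= 0 ->
        (\esum_(v in [set: tvec R]) ((v ord0 l)%:R * off i k v)%:E
         = (mean_matrix Q w i k l)%:E)%E) /\
    (forall j : nat, (j < R)%N ->
      Q 0 w [set x | U R 1 x = evec R (kappa R j 1)]
      = (p w j.+1 0 / pstop Q w 0)%:E) /\
    (forall j m : nat, (j + 2 <= R)%N -> (2 <= m <= R - j)%N ->
      Q 0 w [set x | U R 1 x = evec R (kappa R j m)]
      = (pcross Q w (kappa R j.+1 m.-1) 0 / pstop Q w 0)%:E) /\
    (forall (u : R.-tuple nat) (j : nat), (j < R)%N ->
      cond_prob (Q 0 w)
        [set x | U R 0 x = padvec u /\ U R 1 x = evec R (kappa R j 1)]
        [set x | vsize (U R 1 x) = 1%N]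
      = multinomial_weight Q w 0 u * p w j.+1 0) /\
    (forall (u : R.-tuple nat) (j m : nat),
      (j + 2 <= R)%N -> (2 <= m <= R - j)%N ->
      cond_prob (Q 0 w)
        [set x | U R 0 x = padvec u + evec R (kappa R j.+1 m.-1) /\
                 U R 1 x = evec R (kappa R j m)]
        [set x | vsize (U R 1 x) = 1%N]
      = multinomial_weight Q w 0 u * pcross Q w (kappa R j.+1 m.-1) 0)}.
Proof.
move: (ae_q_lt1 hR Pstat Pell) (ae_transient htrans).
apply: filterS2 => w q_lt1 trans.
have Q1 i : Q i w setT = 1%E by exact: prob_kernel.
have Qlaw i : walk_law w i (Q i w) by exact: hQ.
have escape := transient_escape (Q1 0) trans.
have jm1 j : (j < R)%N -> type_pair R j 1 by rewrite /type_pair; lia.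
have jm2 j m : (j + 2 <= R)%N -> (2 <= m <= R - j)%N -> type_pair R j m.
  by rewrite /type_pair; lia.
have ev2 j m : (2 <= m <= R - j)%N -> @exit_vec R (j, m) = evec R (kappa R j.+1 m.-1).
  by move=> mR; rewrite /exit_vec /= ifF //; lia.
split; [|split; [|split; [|split]]].
- exists (offspring_law w); split; first exact: (walk_branching (Q := Q)).
  by move=> i k l _; exact: (walk_mean (Q := Q)).
- by move=> j jR; rewrite (immigration (Q := Q)) // jm1.
- move=> j m jR mR; rewrite -(exit_weight_pcross (Q := Q)) //.
  by apply: (immigration (Q := Q)) => //; exact: jm2.
- move=> u j jR; have := first_generation (Q := Q) Q1 Qlaw q_lt1 escape u (jm1 _ jR).
  by rewrite /exit_vec /= addr0.
- move=> u j m jR mR; have := first_generation (Q := Q) Q1 Qlaw q_lt1 escape u (jm2 _ _ jR mR).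
  by rewrite ev2 // (exit_weight_pcross (Q := Q)).
Qed.
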